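(* There is an absolute constant $C>0$ such that the following holds. Let $1\le n\le m$ be integers, let $A$ be a real $m\times n$ matrix of full column rank whose rows $a_1,\dots,a_m$ all satisfy $\|a_i\|_2=1$, and consider the homogeneous system $Ax=0$, whose solution is $x=0$. Let $\delta>0$ and let $d$ be a positive integer with $d=C\delta^{-2}\log n$. Fix a vector $x_k\in\mathbb{R}^n$ with $\|x_k\|_2\le 1$, and let $x_{k+1}$ and $x_{k+1}^*$ be the (random) next estimates obtained from $x_k$ by one iteration of the RKJL method (with $d\times n$ Gaussian matrix $\Phi$) and by one iteration of the standard randomized Kaczmarz (RK) method, respectively. Set $\gamma_j^*=|\langle a_j,x_k\rangle|^2$ for $j=1,\dots,m$, with the rows indexed so that $\gamma_1^*\ge\gamma_2^*\ge\dots\ge\gamma_m^*$. Then $$ \mathbb{E}\|x_{k+1}-x\|_2^2\;\le\;\min\left[\mathbb{E}\|x_{k+1}^*-x\|_2^2-\sum_{j=1}^m\Big(p_j-\frac1m\Big)\gamma_j^*+2\delta,\;\; \mathbb{E}\|x_{k+1}^*-x\|_2^2\right], $$ where $$ p_j=\begin{cases}\dfrac{\binom{m-j}{n-1}}{\binom{m}{n}}, & j\le m-n+1,\\[2mm] 0,& j>m-n+1,\end{cases} $$ are non-negative values satisfying $\sum_{j=1}^m p_j=1$ and $p_1\ge p_2\ge\dots\ge p_m=0$.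
   Context: Both iterations are described for the system $Ax=0$ where all rows $a_i$ of $A$ have unit Euclidean norm. Standard RK iteration: choose an index $i\in\{1,\dots,m\}$ with probability $\|a_i\|_2^2/\|A\|_F^2=1/m$, and set $x_{k+1}^*=x_k-\langle a_i,x_k\rangle a_i$. RKJL iteration: let $\Phi$ be a $d\times n$ random matrix with i.i.d. Gaussian entries of mean $0$ and variance $1/d$, and let $\alpha_i=\Phi a_i$. (Select) Choose $n$ distinct rows of $A$ at random, independently of $\Phi$, one after another, uniformly without replacement (so that the chosen set is a uniformly random $n$-subset of the rows, and the first chosen row is uniformly distributed over all rows). For each chosen row compute $\gamma_i=|\langle\alpha_i,\Phi x_k\rangle|/\|\alpha_i\|_2$, and let $j$ be an index maximizing $\gamma_i$ among the chosen rows. (Test) Let $l$ be the index of the first chosen row. If $|\langle a_l,x_k\rangle|>|\langle a_j,x_k\rangle|$, replace $j$ by $l$. (Project) Set $x_{k+1}=x_k-\langle a_j,x_k\rangle a_j$. The vector $x_k$ is fixed (non-random), and $\mathbb{E}$ denotes expectation over all randomness used in the iteration in question (the random choice of rows and, for RKJL, the matrix $\Phi$). *)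

(* Defs.v *)
From HB Require Import structures.
From mathcomp Require Export all_boot all_order all_algebra all_fingroup.
From mathcomp Require Export all_classical all_reals all_analysis.

Set Implicit Arguments.
Unset Strict Implicit.
Unset Printing Implicit Defensive.

Export Order.TTheory GRing.Theory Num.Theory numFieldNormedType.Exports.

Local Open Scope classical_set_scope.
Local Open Scope ring_scope.

(* The library norm `|v| of a matrix is the sup norm, hence the explicit
   Euclidean structure. *)
Definition dotv (R : realType) (n : nat) (u v : 'cV[R]_n) : R :=
  \sum_(i < n) u i 0 * v i 0.

Definition norm2 (R : realType) (n : nat) (u : 'cV[R]_n) : R :=
  Num.sqrt (dotv u u).

Definition frobenius (R : realType) (m n : nat) (A : 'M[R]_(m, n)) : R :=
  Num.sqrt (\sum_(i < m) \sum_(j < n) A i j ^+ 2).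

Definition arow (R : realType) (m n : nat) (A : 'M[R]_(m, n)) (i : 'I_m) :
  'cV[R]_n := (row i A)^T.

Definition project (R : realType) (m n : nat) (A : 'M[R]_(m, n))
    (x : 'cV[R]_n) (i : 'I_m) : 'cV[R]_n :=
  x - dotv (arow A i) x *: arow A i.

(* For a random variable with finitely many values, measurability amounts to
   measurability of the fibres. *)
Definition finite_rv (disp : measure_display) (T : measurableType disp)
    (F : finType) (X : T -> F) : Prop :=
  forall f : F, measurable (X @^-1` [set f]).

Definition mutually_independent (R : realType) (disp : measure_display)
    (T : measurableType disp) (P : probability T R) (I : finType)
    (X : I -> {RV P >-> R}) : Prop :=
  forall (J : {set I}) (B : I -> set R),
    (forall i, measurable (B i)) ->
    P (\bigcap_(i in [set` J]) (X i @^-1` B i)) =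
    (\prod_(i in J) P (X i @^-1` B i))%E.

Definition sigma_rvs (R : realType) (disp : measure_display)
    (T : measurableType disp) (P : probability T R) (I : Type)
    (X : I -> {RV P >-> R}) : set (set T) :=
  <<s [set E | exists i B, measurable B /\ E = X i @^-1` B] >>.

Definition independent_of_rvs (R : realType) (disp : measure_display)
    (T : measurableType disp) (P : probability T R) (F : finType) (S : T -> F)
    (I : Type) (X : I -> {RV P >-> R}) : Prop :=
  forall (f : F) (E : set T), sigma_rvs X E ->
    P (S @^-1` [set f] `&` E) = (P (S @^-1` [set f]) * P E)%E.

(* The second parameter of [normal_prob] is the standard deviation. *)
Definition iid_gaussian (R : realType) (disp : measure_display)
    (T : measurableType disp) (P : probability T R) (d n : nat)
    (Phi : 'I_d * 'I_n -> {RV P >-> R}) : Prop :=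
  mutually_independent Phi /\
  forall (e : 'I_d * 'I_n) (B : set R), measurable B ->
    distribution P (Phi e) B = normal_prob 0 (Num.sqrt d%:R^-1) B.

Definition sample_mx (R : realType) (disp : measure_display)
    (T : measurableType disp) (P : probability T R) (d n : nat)
    (Phi : 'I_d * 'I_n -> {RV P >-> R}) (w : T) : 'M[R]_(d, n) :=
  \matrix_(i < d, j < n) Phi (i, j) w.

(* [S w k] is the (k+1)-st chosen row; sampling one after another uniformly
   without replacement gives the uniform law on the m (m-1) ... (m-n+1)
   injections. *)
Definition without_replacement (R : realType) (disp : measure_display)
    (T : measurableType disp) (P : probability T R) (m n : nat)
    (S : T -> {ffun 'I_n -> 'I_m}) : Prop :=
  [/\ finite_rv S,
      forall w, injective (S w) &
      forall f : {ffun 'I_n -> 'I_m}, injective f ->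
        P (S @^-1` [set f]) = ((m ^_ n)%:R^-1)%:E].

Definition rkjl_gamma (R : realType) (d m n : nat) (A : 'M[R]_(m, n))
    (M : 'M[R]_(d, n)) (x : 'cV[R]_n) (i : 'I_m) : R :=
  `|dotv (M *m arow A i) (M *m x)| / norm2 (M *m arow A i).

Definition rkjl_select (R : realType) (d m n : nat) (A : 'M[R]_(m, n))
    (M : 'M[R]_(d, n)) (x : 'cV[R]_n) (f : 'I_n -> 'I_m) (j : 'I_m) : Prop :=
  (exists k, j = f k) /\
  forall k, rkjl_gamma A M x (f k) <= rkjl_gamma A M x j.

Definition rkjl_test (R : realType) (m n : nat) (A : 'M[R]_(m, n))
    (x : 'cV[R]_n) (l j : 'I_m) : 'I_m :=
  if `|dotv (arow A j) x| < `|dotv (arow A l) x| then l else j.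

(* The maximizing index J is only constrained to be a maximizer: ties may be
   broken in any (measurable) way. *)
Definition rkjl_iteration (R : realType) (disp : measure_display)
    (T : measurableType disp) (P : probability T R) (d m n : nat)
    (A : 'M[R]_(m, n)) (x : 'cV[R]_n) (y : T -> 'cV[R]_n) : Prop :=
  exists (Phi : 'I_d * 'I_n -> {RV P >-> R}) (S : T -> {ffun 'I_n -> 'I_m})
         (J : T -> 'I_m),
    [/\ iid_gaussian Phi,
        without_replacement P S,
        independent_of_rvs S Phi,
        finite_rv J /\
          (forall w, rkjl_select A (sample_mx Phi w) x (S w) (J w)) &
        forall (w : T) (k : 'I_n), k = 0%N :> nat ->
          y w = project A x (rkjl_test A x (S w k) (J w))].

Definition rk_iteration (R : realType) (disp : measure_display)
    (T : measurableType disp) (P : probability T R) (m n : nat)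
    (A : 'M[R]_(m, n)) (x : 'cV[R]_n) (y : T -> 'cV[R]_n) : Prop :=
  exists I : T -> 'I_m,
    [/\ finite_rv I,
        forall i, P (I @^-1` [set i]) =
          (norm2 (arow A i) ^+ 2 / frobenius A ^+ 2)%:E &
        forall w, y w = project A x (I w)].

(* Here j is the 1-based index, 1 <= j <= m. *)
Definition rank_prob (R : realType) (m n j : nat) : R :=
  if (j <= m - n + 1)%N then 'C(m - j, n - 1)%:R / 'C(m, n)%:R else 0.

(* Main.v *)
(* Writing gamma_i^* = <a_i, x_k>^2, a projection on row i decreases the squared
   error by gamma_i^*, so everything is about E gamma_j^* for the row j that is
   finally used.  The test against the first chosen row, which is uniformly
   distributed, gives the comparison with RK.  For the other bound, the best
   chosen row has expected value sum_j p_j gamma_j^*, and the loss incurred by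
   selecting with the sketched quantities is at most 12 times the maximal
   distortion | ||Phi u||^2 - ||u||^2 | over the 3n vectors u = a_i, a_i + x_k,
   a_i - x_k (polarization).  The expectation of this maximum is estimated
   through exponential moments (a union bound on the tails would leave a failure
   probability that is not O(delta) for small delta): with lambda = 30 ln n / delta
   and M = 6 n^2,  lambda max |q| <= ln M - 1 + M^-1 sum (e^(lambda q) + e^(- lambda q)).

   The exponential moments of ||Phi u||^2 are obtained from the independence of
   the entries of Phi without computing any law: the product rule
   E [K prod_i h_i(X_i)] = q prod_i c_i is transported, one factor at a time, from
   indicator functions to exponentials, then to e^(s x^2) by averaging e^(t x)
   over a Gaussian t, and finally to combinations of these that dominate
   e^(- s x^2). *)

Require Import Defs.
From mathcomp Require Import measurable_realfun.
From mathcomp Require Import ring lra zify.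

Set Implicit Arguments.
Unset Strict Implicit.
Unset Printing Implicit Defensive.

Local Open Scope classical_set_scope.
Local Open Scope ring_scope.

(** * Product rules for independent factors *)

Section density.
Local Open Scope ereal_scope.
Import HBNNSimple.
Context d d' (T : measurableType d) (Y : measurableType d') (R : realType).
Variables (mu : {measure set T -> \bar R}) (nu : {measure set Y -> \bar R}).
Variables (K : T -> R) (X : T -> Y) (q : R).
Hypotheses (mK : measurable_fun setT K) (K0 : forall w, (0 <= K w)%R).
Hypotheses (mX : measurable_fun setT X).
Hypothesis KX : forall B, measurable B ->
  \int[mu]_w (K w * \1_B (X w))%:E = q%:E * nu B.

(** [KX] says, on sets, that [X] pushes the measure with density [K] forward to [q] times [nu].
    Simple functions and monotone convergence carry this to nonnegative functions. The weight [K]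
    leaves room for the other factors of a product. *)
Lemma integral_density_pushforward (f : Y -> R) :
  measurable_fun [set: Y] f -> (forall x, (0 <= f x)%R) ->
  \int[mu]_w (K w * f (X w))%:E = q%:E * \int[nu]_x (f x)%:E.
Proof.
move=> mf f0.
have mEf : measurable_fun [set: Y] (EFin \o f) by exact/measurable_EFinP.
pose h := nnsfun_approx measurableT mEf.
have hcvg x : (h n x)%:E @[n --> \oo] --> (f x)%:E.
  by apply: (@cvg_nnsfun_approx _ _ _ _ measurableT _ mEf) => //= y _; rewrite lee_fin.
have hnd x a b : (a <= b)%N -> (h a x <= h b x)%R.
  by move=> ab; exact/lefP/nd_nnsfun_approx.
have mh n : measurable_fun [set: Y] (fun x => (h n x)%:E).
  exact/measurable_EFinP.
have mKh n : measurable_fun setT (fun w => (K w * h n (X w))%:E).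
  apply/measurable_EFinP/measurable_funM => //.
  by apply: measurableT_comp => //; exact/measurable_EFinP.
have -> : \int[nu]_x (f x)%:E = limn (fun n => \int[nu]_x (h n x)%:E).
  rewrite -monotone_convergence//.
  - by apply: eq_integral => x _; apply/esym/cvg_lim => //; exact: hcvg.
  - by move=> n x _; rewrite lee_fin.
  - by move=> x _ a b ab; rewrite lee_fin hnd.
have -> : \int[mu]_w (K w * f (X w))%:E =
    limn (fun n => \int[mu]_w (K w * h n (X w))%:E).
  rewrite -monotone_convergence//.
  - apply: eq_integral => w _; apply/esym/cvg_lim => //.
    rewrite EFinM; under eq_fun do rewrite EFinM.
    by apply: cvgeZl => //; exact: hcvg.
  - by move=> n w _; rewrite lee_fin mulr_ge0.
  - by move=> x _ a b ab; rewrite lee_fin ler_wpM2l ?hnd.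
rewrite -limeMl //; last first.
  apply: ereal_nondecreasing_is_cvgn => a b ab; apply: ge0_le_integral => //.
  - by move=> x _; rewrite lee_fin.
  - by move=> x _; rewrite lee_fin hnd.
congr (limn _); apply/funext => n.
have E1 x : (h n x)%:E = \sum_(y \in range (h n)) (y * \1_(h n @^-1` [set y]) x)%:E.
  by rewrite fimfunE -fsumEFin.
have E2 w : (K w * h n (X w))%:E =
   \sum_(y \in range (h n)) (K w * (y * \1_(h n @^-1` [set y]) (X w)))%:E.
  rewrite EFinM E1 ge0_mule_fsumr //.
  by move=> y; exact: nnfun_muleindic_ge0.
under eq_integral do rewrite E2.
under [in RHS]eq_integral do rewrite E1.
have m1 y : measurable_fun [set: Y] (fun x => (y * \1_(h n @^-1` [set y]) x)%:E).
  exact/measurable_EFinP/measurable_funM.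
have p1 y x : 0 <= (y * \1_(h n @^-1` [set y]) x)%:E.
  exact: nnfun_muleindic_ge0.
rewrite !ge0_integral_fsum//; last first.
  by move=> y w _; rewrite EFinM mule_ge0// lee_fin.
  move=> y; apply/measurable_EFinP/measurable_funM => //.
  apply: measurable_funM => //.
  by apply: measurableT_comp => //; exact/measurable_EFinP.
rewrite ge0_mule_fsumr; last by move=> y; apply: integral_ge0.
apply: eq_fsbigr => y; rewrite inE => -[x0 _ <-].
have mB : measurable (h n @^-1` [set h n x0]) by [].
under eq_integral do rewrite mulrCA EFinM.
rewrite ge0_integralZl//; last 3 first.
  - apply/measurable_EFinP/measurable_funM => //.
    by apply: measurableT_comp.
  - by move=> w _; rewrite lee_fin mulr_ge0.
  - by rewrite lee_fin.
rewrite KX//; under [in RHS]eq_integral do rewrite EFinM.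
rewrite ge0_integralZl//; last 2 first.
  - exact/measurable_EFinP.
  - by rewrite lee_fin.
by rewrite integral_indic// setIT muleCA.
Qed.
End density.

Section product_rule.
Context d (T : measurableType d) (R : realType) (mu : {measure set T -> \bar R}).
Variables (I : finType) (X : I -> T -> R) (K0 : T -> R) (q0 : R).
Hypotheses (mX : forall i, measurable_fun setT (X i)).
Hypotheses (mK0 : measurable_fun setT K0) (K0_ge0 : forall w, 0 <= K0 w).
Hypothesis q0_ge0 : 0 <= q0.

(** A pair [(h, c)] is a factor [h] together with the value [c] claimed for its expectation. *)
Definition test_function (v : (R -> R) * R) : Prop :=
  [/\ measurable_fun [set: R] v.1, forall x, 0 <= v.1 x & 0 <= v.2].

Definition product_rule (V : set ((R -> R) * R)) : Prop :=
  forall v : I -> (R -> R) * R, (forall i, V (v i)) ->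
  (\int[mu]_w (K0 w * \prod_i (v i).1 (X i w))%:E = (q0 * \prod_i (v i).2)%:E)%E.

(** The factors are exchanged one at a time: once the factor at [i] is singled out, [K0] times the
    remaining ones is again a nonnegative weight, to which [step] applies. *)
Lemma product_rule_extend (V V' : set ((R -> R) * R)) :
  V `<=` test_function -> V' `<=` test_function ->
  (forall i (K : T -> R) (q : R), measurable_fun setT K -> (forall w, 0 <= K w) -> 0 <= q ->
    (forall v, V v -> (\int[mu]_w (K w * v.1 (X i w))%:E = (q * v.2)%:E)%E) ->
    forall v, V' v -> (\int[mu]_w (K w * v.1 (X i w))%:E = (q * v.2)%:E)%E) ->
  product_rule V -> product_rule V'.
Proof.
move=> VT VT' step rV.
(* [A] is the set of indices whose factor is taken from [V']; the induction is on its size. *)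
suff claim k : forall (A : {set I}) (v : I -> (R -> R) * R), #|A| = k ->
    (forall i, if i \in A then V' (v i) else V (v i)) ->
    (\int[mu]_w (K0 w * \prod_i (v i).1 (X i w))%:E = (q0 * \prod_i (v i).2)%:E)%E.
  move=> v Vv; apply: (claim _ [set: I]%SET v erefl) => i.
  by rewrite inE.
elim: k => [|k IH] A v cA Av.
  by apply: rV => i; have := Av i; move/eqP: cA; rewrite cards_eq0 => /eqP ->; rewrite inE.
have /card_gt0P [i iA] : (0 < #|A|)%N by rewrite cA.
have vT j : test_function (v j).
  by have := Av j; case: ifP => _; [exact: VT'|exact: VT].
pose K w := K0 w * \prod_(j | j != i) (v j).1 (X j w).
pose q := q0 * \prod_(j | j != i) (v j).2.
have mK : measurable_fun setT K.
  have -> : K = fun w => K0 w * \prod_j (if j != i then (v j).1 (X j w) else 1).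
    by apply/funext => w; congr (_ * _); exact: big_mkcond.
  apply: measurable_funM => //; apply: measurable_prod => j _; case: (j != i) => //.
  by have [mv _ _] := vT j; exact: measurableT_comp.
have K_ge0 w : 0 <= K w.
  by rewrite mulr_ge0// prodr_ge0// => j _; have [_ + _] := vT j.
have q_ge0 : 0 <= q.
  by rewrite mulr_ge0// prodr_ge0// => j _; have [_ _ +] := vT j.
have KE (u : (R -> R) * R) w : K w * u.1 (X i w) =
    K0 w * \prod_j (if j == i then u else v j).1 (X j w).
  rewrite (bigD1 i)//= eqxx /K mulrAC -!mulrA; congr (_ * (_ * _)).
  by apply: eq_bigr => j /negbTE ->.
have qE (u : (R -> R) * R) : q * u.2 = q0 * \prod_j (if j == i then u else v j).2.
  rewrite (bigD1 i)//= eqxx /q mulrAC -!mulrA; congr (_ * (_ * _)).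
  by apply: eq_bigr => j /negbTE ->.
have vE j : (if j == i then v i else v j) = v j by case: eqP => [->|].
have -> : q0 * \prod_j (v j).2 = q * (v i).2.
  by rewrite qE; under [in RHS]eq_bigr do rewrite vE.
rewrite -(step i K q mK K_ge0 q_ge0 _ (v i)).
- by apply: eq_integral => w _; rewrite KE; under [in RHS]eq_bigr do rewrite vE.
- move=> u Vu; rewrite qE; under eq_integral do rewrite KE.
  rewrite (IH (A :\ i)%SET (fun j => if j == i then u else v j))//.
    by move: cA; rewrite (cardsD1 i A) iA add1n => -[].
  move=> j; rewrite in_setD1; case: eqP => //= _; exact: Av.
- by have := Av i; rewrite iA.
Qed.
End product_rule.

(** * Exponential moments of Gaussian sketches *)

Section gaussian.
Context (R : realType).
Local Notation leb := (@lebesgue_measure R).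

Lemma integral_normal_prob (m s : R) (f : R -> R) :
  measurable_fun [set: R] f -> (forall x, 0 <= f x) ->
  (\int[normal_prob m s]_x (f x)%:E = \int[leb]_x (normal_pdf m s x * f x)%:E)%E.
Proof.
move=> mf f0; rewrite -[LHS]mul1e; apply/esym.
(* The Gaussian density is the weight, with [X] the identity and [q = 1]. *)
apply: (@integral_density_pushforward _ _ (measurableTypeR R) (measurableTypeR R) R leb
  (normal_prob m s) (normal_pdf m s) idfun 1) => //.
- exact: measurable_normal_pdf.
- exact: normal_pdf_ge0.
- by move=> _ B mB; rewrite setTI.
move=> B mB; rewrite mul1e /normal_prob /= [RHS]integral_mkcond.
apply: eq_integral => x _; rewrite patchE indicE.
by case: (x \in B); rewrite ?mulr1 ?mulr0.
Qed.

Lemma normal_mgf (s t : R) : s != 0 ->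
  (\int[normal_prob 0 s]_x (expR (t * x))%:E = (expR (t ^+ 2 * s ^+ 2 / 2))%:E)%E.
Proof.
move=> s0; rewrite integral_normal_prob//; last first.
  apply: measurableT_comp => //; exact: measurable_funM.
under eq_integral => x _.
  (* Completing the square moves the mean to [t * s ^+ 2]. *)
  have -> : normal_pdf 0 s x * expR (t * x) =
            expR (t ^+ 2 * s ^+ 2 / 2) * normal_pdf (t * s ^+ 2) s x.
    rewrite !normal_pdfE// /normal_fun mulrCA -!mulrA -!expRD; congr (_ * expR _).
    by field.
  rewrite EFinM; over.
rewrite ge0_integralZl//.
- by rewrite integral_normal_pdf mule1.
- by apply/measurable_EFinP; exact: measurable_normal_pdf.
- by move=> x _; rewrite lee_fin normal_pdf_ge0.
Qed.

(** The extra factor only changes the variance of the density, to [s ^+ 2 / (1 - t * s ^+ 2 * 2)];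
    the result is the ratio of the two normalizing constants. *)
Lemma normal_square_mgf (s t : R) : s != 0 -> t * s ^+ 2 * 2 < 1 ->
  (\int[normal_prob 0 s]_x (expR (t * x ^+ 2))%:E =
   ((Num.sqrt (1 - t * s ^+ 2 * 2))^-1)%:E)%E.
Proof.
move=> s0 ts; rewrite integral_normal_prob//; last first.
  apply: measurableT_comp => //; apply: measurable_funM => //; exact: measurable_funX.
set r := 1 - t * s ^+ 2 * 2.
have r0 : 0 < r by rewrite subr_gt0.
pose s' := s / Num.sqrt r.
have sr0 : 0 < Num.sqrt r by rewrite sqrtr_gt0.
have s'0 : s' != 0 by rewrite mulf_neq0// invr_eq0 gt_eqF.
have s'2 : s' ^+ 2 = s ^+ 2 / r by rewrite expr_div_n sqr_sqrtr// ltW.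
under eq_integral => x _.
  have -> : normal_pdf 0 s x * expR (t * x ^+ 2) =
            (Num.sqrt r)^-1 * normal_pdf 0 s' x.
    rewrite !normal_pdfE// /normal_fun -mulrA -expRD.
    have -> : normal_peak s' = Num.sqrt r * normal_peak s.
      rewrite /normal_peak s'2 -[_ * pi *+ 2]mulr_natr.
      rewrite (_ : s ^+ 2 / r * pi * 2 = (s ^+ 2 * pi *+ 2) / r); last first.
        by rewrite -mulr_natr; field; rewrite gt_eqF.
      rewrite sqrtrM ?sqrtrV ?invfM ?invrK 1?mulrC//; last first.
        by rewrite mulrn_wge0// mulr_ge0 ?sqr_ge0 ?pi_ge0.
      by rewrite ltW.
    rewrite !mulrA mulVf ?mul1r; last by rewrite gt_eqF.
    congr (_ * expR _); rewrite s'2 /r.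
    by field; rewrite s0 gt_eqF.
  rewrite EFinM; over.
rewrite ge0_integralZl//.
- by rewrite integral_normal_pdf mule1.
- by apply/measurable_EFinP; exact: measurable_normal_pdf.
- by move=> x _; rewrite lee_fin normal_pdf_ge0.
Qed.

End gaussian.

(** The second component is the moment generating function at [t] of a centred Gaussian of variance
    [v]. *)
Definition exp_tests (R : realType) (v : R) : set ((R -> R) * R) :=
  [set (fun x => expR (t * x), expR (t ^+ 2 * v / 2)) | t in setT].

(** Exponential moments of the square of a centred Gaussian of variance [v]. The condition [0 <= t]
    lets [2 * t] serve as a variance when averaging exponentials. *)
Definition square_exp_tests (R : realType) (v : R) : set ((R -> R) * R) :=
  [set (fun x => expR (t * x ^+ 2), (Num.sqrt (1 - t * v * 2))^-1)
    | t in [set t | 0 <= t /\ t * v * 2 < 1]].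

Lemma measurable_expM (R : realType) (t : R) :
  measurable_fun [set: R] (fun x => expR (t * x)).
Proof. by apply: measurableT_comp => //; exact: measurable_funM. Qed.

Lemma measurable_expM2 (R : realType) (t : R) :
  measurable_fun [set: R] (fun x => expR (t * x ^+ 2)).
Proof.
by apply: measurableT_comp => //; apply: measurable_funM => //; exact: measurable_funX.
Qed.

Lemma exp_tests_test (R : realType) (v : R) : exp_tests v `<=` @test_function R.
Proof.
by move=> _ [t _ <-]; split => /=; rewrite ?expR_ge0//; exact: measurable_expM.
Qed.

Lemma square_exp_tests_test (R : realType) (v : R) :
  square_exp_tests v `<=` @test_function R.
Proof.
move=> _ [t _ <-]; split => /=; first exact: measurable_expM2.
  by move=> x; rewrite expR_ge0.
by rewrite invr_ge0 sqrtr_ge0.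
Qed.

Section gaussian_rule.
Context (R : realType) (disp : measure_display) (T : measurableType disp).
Context (P : probability T R) (d n : nat).
Context (Phi : 'I_d * 'I_n -> {RV P >-> R}) (F : finType) (S : T -> F) (f : F).
Hypothesis d_gt0 : (0 < d)%N.
Hypothesis iid : iid_gaussian Phi.
Hypotheses (finS : finite_rv S) (SPhi : independent_of_rvs S Phi).

Let K0 (w : T) : R := \1_(S @^-1` [set f]) w.
Let q0 : R := fine (P (S @^-1` [set f])).

Let K0_ge0 w : 0 <= K0 w. Proof. by rewrite /K0 indicE. Qed.
Let mK0 : measurable_fun setT K0. Proof. exact: measurable_indic. Qed.
Let q0_ge0 : 0 <= q0. Proof. exact: fine_ge0. Qed.

Local Notation sigma := (Num.sqrt (d%:R^-1 : R)).

(** The probabilistic hypotheses enter here: independence of the entries, their law, and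
    independence of [S] from the matrix. *)
Lemma product_rule_indic : product_rule P (fun e => Phi e : T -> R) K0 q0
  [set (\1_B : R -> R, fine (normal_prob 0 sigma B)) | B in measurable].
Proof.
move=> v Vv.
have /choice [B BP] : forall e, exists B : set R, measurable B /\
    v e = (\1_B : R -> R, fine (normal_prob 0 sigma B)).
  by move=> e; have [B mB <-] := Vv e; exists B.
pose E := \bigcap_(e in [set` [set: 'I_d * 'I_n]%SET]) (Phi e @^-1` B e).
have mPhi e : measurable (Phi e @^-1` B e).
  rewrite -[_ @^-1` _]setTI; apply: measurable_funP => //.
  by have [] := BP e.
have mE : measurable E.
  by apply: fin_bigcap_measurable => // e _; exact: mPhi.
have KE w : K0 w * \prod_e (v e).1 (Phi e w) = \1_(S @^-1` [set f] `&` E) w.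
  rewrite indicI/=; congr (_ * _).
  under eq_bigr => e _ do rewrite (BP e).2 /=.
  rewrite [RHS]indicE; case: (boolP (w \in E)).
    rewrite inE => Ew; rewrite big1// => e _.
    by rewrite indicE mem_set//; apply: Ew => /=; rewrite inE.
  move=> /negP Ew; apply/eqP; rewrite prodf_seq_eq0; apply/hasP.
  apply: contrapT => nE; apply: Ew; rewrite inE => e _ /=.
  apply: contrapT => Be; apply: nE; exists e; first exact: mem_index_enum.
  by rewrite /= indicE memNset.
under eq_integral do rewrite KE.
rewrite integral_indic// ?setIT; last by apply: measurableI => //; exact: finS.
(* Independence from [S] is stated on the generated sigma-algebra, so [E] has to be shown to lie in
   it. *)
have sE : sigma_rvs Phi E.
  rewrite /sigma_rvs.
  apply: (@fin_bigcap_measurable _ (g_sigma_algebraType [set E0 | exists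
    (e : 'I_d * 'I_n) (B : set R), measurable B /\ E0 = Phi e @^-1` B])) => // e _.
  apply: sub_sigma_algebra.
  by exists e, (B e); split => //; have [] := BP e.
rewrite [LHS](SPhi f sE).
have [ind law] := iid.
rewrite ind; last by move=> e; have [] := BP e.
have -> : P (S @^-1` [set f]) = q0%:E.
  by rewrite fineK// fin_num_measure//; exact: finS.
rewrite EFinM; congr (_ * _)%E; rewrite -prodEFin; apply: eq_big => [e|e _]; first by rewrite inE.
rewrite (BP e).2 /= -(law e (B e)); last by have [] := BP e.
by rewrite fineK// fin_num_measure//; have [] := BP e.
Qed.

Lemma sigma_neq0 : sigma != 0.
Proof. by rewrite gt_eqF// sqrtr_gt0 invr_gt0 ltr0n. Qed.

Lemma sigma2 : sigma ^+ 2 = d%:R^-1 :> R.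
Proof. by rewrite sqr_sqrtr// invr_ge0 ler0n. Qed.

Lemma product_rule_entries :
  product_rule P (fun e => Phi e : T -> R) K0 q0 (exp_tests (d%:R^-1)).
Proof.
have mPhi e : measurable_fun setT (Phi e : T -> R) by [].
apply: (product_rule_extend mPhi mK0 K0_ge0 q0_ge0 _ _ _ product_rule_indic).
- move=> _ [B mB <-]; split => //=; exact: fine_ge0.
- exact: exp_tests_test.
move=> e K q mK K_ge0 q_ge0 KV _ [t _ <-] /=.
(* The rule for indicators is the hypothesis [KX] for the Gaussian law, so it transfers to
   exponentials. *)
rewrite (@integral_density_pushforward _ _ T (measurableTypeR R) R P
  (normal_prob 0 sigma) K (Phi e) q mK K_ge0 _ _ (fun x => expR (t * x)))//.
- by rewrite normal_mgf ?sigma_neq0// sigma2.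
- exact: (mPhi e).
- move=> B mB; have := KV (\1_B, fine (normal_prob 0 sigma B)) => /= ->.
    by rewrite EFinM fineK// fin_num_measure.
  by exists B.
- exact: measurable_expM.
Qed.

(** The exponential of a linear form splits into exponentials of the entries, with parameters
    [t r * u j 0], and the variances [u j 0 ^+ 2 / d%:R] add up. *)
Lemma product_rule_rows (u : 'cV[R]_n) :
  product_rule P (fun r w => (sample_mx Phi w *m u) r 0) K0 q0
    (exp_tests (dotv u u / d%:R)).
Proof.
move=> v Vv.
have /choice [t tP] : forall r, exists t, v r =
    (fun x => expR (t * x), expR (t ^+ 2 * (dotv u u / d%:R) / 2)).
  by move=> r; have [t _ <-] := Vv r; exists t.
pose v' (e : 'I_d * 'I_n) : (R -> R) * R :=
  (fun x => expR (t e.1 * u e.2 0 * x), expR ((t e.1 * u e.2 0) ^+ 2 * d%:R^-1 / 2)).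
have := product_rule_entries (v := v') _.
rewrite (_ : q0 * \prod_r (v r).2 = q0 * \prod_e (v' e).2); last first.
  congr (_ * _); rewrite -(pair_bigA _ (fun r j => (v' (r, j)).2))/=.
  apply: eq_bigr => r _; rewrite tP/= -expR_sum; congr expR.
  rewrite -mulr_suml -mulr_suml /dotv.
  under [in RHS]eq_bigr do rewrite exprMn expr2.
  by rewrite -mulr_sumr !mulrA.
move=> <-; last by move=> e; exists (t e.1 * u e.2 0).
apply: eq_integral => w _; congr (_ * _)%:E.
transitivity (\prod_r \prod_j (v' (r, j)).1 (Phi (r, j) w)); last first.
  by rewrite pair_bigA; apply: eq_bigr => -[].
apply: eq_bigr => r _; rewrite tP/= -expR_sum; congr expR.
rewrite mxE mulr_sumr; apply: eq_bigr => j _; rewrite mxE.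
by rewrite mulrA mulrAC.
Qed.

Lemma product_rule_square (v : R) (X : 'I_d -> T -> R) :
  (forall r, measurable_fun setT (X r)) ->
  product_rule P X K0 q0 (exp_tests v) ->
  product_rule P X K0 q0 (square_exp_tests v).
Proof.
move=> mX; apply: (product_rule_extend mX mK0 K0_ge0 q0_ge0).
- exact: exp_tests_test.
- exact: square_exp_tests_test.
move=> r K q mK K_ge0 q_ge0 KV _ [s [s_ge0 sv] <-] /=.
(* The averaging Gaussian below must have positive variance; for [s = 0] the factor is the constant
   1. *)
have [->|s_neq0] := eqVneq s 0.
  have := KV (fun x => expR (0 * x), expR (0 ^+ 2 * v / 2)).
  rewrite !mul0r subr0 sqrtr1 invr1 expr0n/= !mul0r expR0 => <-; last first.
    by exists 0 => //; rewrite expr0n/= !mul0r expR0.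
  by apply: eq_integral => w _; rewrite !mul0r.
pose tau := Num.sqrt (s * 2).
have tau2 : tau ^+ 2 = s * 2 by rewrite sqr_sqrtr// mulr_ge0.
have tau0 : tau != 0.
  by rewrite gt_eqF// sqrtr_gt0 mulr_gt0// lt_def s_neq0.
(* Hubbard-Stratonovich transform *)
have mix x : (expR (s * x ^+ 2))%:E =
    (\int[normal_prob 0 tau]_t (expR (x * t))%:E)%E.
  by rewrite normal_mgf// tau2; congr (expR _)%:E; field.
pose k (z : T * measurableTypeR R) : \bar R := (K z.1 * expR (X r z.1 * z.2))%:E.
have k_ge0 z : (0 <= k z)%E by rewrite lee_fin mulr_ge0 ?expR_ge0.
have mk : measurable_fun setT k.
  apply/measurable_EFinP; apply: measurable_funM.
    exact: measurableT_comp.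
  apply: measurableT_comp => //; apply: measurable_funM => //.
  exact: measurableT_comp.
transitivity (\int[P]_w \int[normal_prob 0 tau]_t k (w, t))%E.
  apply: eq_integral => w _; rewrite EFinM mix -ge0_integralZl ?lee_fin//.
  - by apply/measurable_EFinP; exact: measurable_expM.
(* By Tonelli the integral over [w] comes first and is given by the rule for exponentials. A square
   moment under a Gaussian of variance [s * 2] remains. *)
rewrite (fubini_tonelli k)//.
transitivity (\int[normal_prob 0 tau]_t (q%:E * (expR (v / 2 * t ^+ 2))%:E))%E.
  apply: eq_integral => t _; rewrite -EFinM (_ : v / 2 * t ^+ 2 = t ^+ 2 * v / 2); last by ring.
  rewrite -(KV (fun x => expR (t * x), expR (t ^+ 2 * v / 2))); last by exists t.
  by apply: eq_integral => w _; rewrite /k/= [X r w * t]mulrC.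
rewrite ge0_integralZl//; last by apply/measurable_EFinP; exact: measurable_expM2.
rewrite normal_square_mgf//; last by rewrite tau2; apply: le_lt_trans sv; lra.
by rewrite EFinM tau2; congr (_ * (Num.sqrt _)^-1%:E)%E; field.
Qed.

End gaussian_rule.

(** * Elementary bounds for inverse square roots and exponentials *)

Section scalar_bounds.
Context (R : realType).
Implicit Types a y z r : R.

(** After squaring, this is [1 / (1 - a) <= 1 + a + 2 * a ^+ 2], valid up to [a = 1 / 2], followed
    by [1 + x <= expR x]. *)
Lemma inv_sqrt_le_expR a : 0 <= a <= 1 / 2 ->
  (Num.sqrt (1 - a))^-1 <= expR (a / 2 + a ^+ 2).
Proof.
move=> /andP[a0 a1]; rewrite -sqrtrV; last lra.
rewrite -[leRHS]ger0_norm ?expR_ge0// -sqrtr_sqr ler_wsqrtr//.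
rewrite -expRM_natl; apply: le_trans (expR_ge1Dx _).
rewrite -div1r ler_pdivrMr; last lra.
have -> : (1 + 2%:R * (a / 2 + a ^+ 2)) * (1 - a) = 1 + a ^+ 2 * (1 - 2 * a) by field.
by rewrite lerDl mulr_ge0 ?sqr_ge0//; lra.
Qed.

Lemma inv_sqrt_ge a : 0 <= a < 1 -> 1 + a / 2 <= (Num.sqrt (1 - a))^-1.
Proof.
move=> /andP[a0 a1].
rewrite -[leRHS]div1r ler_pdivlMr ?sqrtr_gt0; last lra.
have e0 : 0 <= 1 + a / 2 by lra.
rewrite -[X in X * _](ger0_norm e0) -sqrtr_sqr -sqrtrM ?sqr_ge0//.
rewrite -[leRHS]sqrtr1 ler_wsqrtr//.
have -> : (1 + a / 2) ^+ 2 * (1 - a) = 1 - a ^+ 2 * (3 / 4 + a / 4) by field.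
by rewrite gerBl mulr_ge0 ?sqr_ge0//; lra.
Qed.

Lemma inv_sqrt_le2 a : a <= 1 / 2 -> (Num.sqrt (1 - a))^-1 <= 2.
Proof.
move=> a1; rewrite invf_ple ?posrE ?sqrtr_gt0//; last lra.
have e : 0 <= 2^-1 :> R by [].
rewrite -(ger0_norm e) -sqrtr_sqr ler_wsqrtr// expr2; lra.
Qed.

(* Lets lower tails be estimated with positive exponents only: the right-hand
   side is a combination of functions whose product rule is available. *)
Lemma expRN_le y z r : 0 <= z -> 0 <= r -> y = r * z ->
  expR (- y) <= 2 - expR y + 4 * r ^+ 2 * expR (z + y).
Proof.
move=> z0 r0 yE; have y0 : 0 <= y by rewrite yE mulr_ge0.
have ey : expR y * expR (- y) = 1 by rewrite expRxMexpNx_1.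
have E1 : 0 <= 1 - expR (- y) <= y.
  by have := expR_ge1Dx (- y); rewrite subr_ge0 expR_le1; lra.
have E2 : z ^+ 2 <= 4 * expR z.
  have := expR_ge1Dx (z / 2); rewrite [in X in _ -> _ <= _ * X](splitr z) expRD.
  move: (expR _) => w; nra.
(* By [ey] the left-hand side expands to [expR y - 2 + expR (- y)], which is where the stated
   combination comes from. *)
have E3 : expR y * (1 - expR (- y)) ^+ 2 <= expR y * (r ^+ 2 * (4 * expR z)).
  rewrite ler_wpM2l ?expR_ge0//; apply: (@le_trans _ _ (y ^+ 2)); first by nra.
  by rewrite yE exprMn ler_wpM2l ?sqr_ge0.
rewrite expRD; move: E3.
have -> : expR y * (1 - expR (- y)) ^+ 2 =
  expR y - 2 * (expR y * expR (- y)) + (expR y * expR (- y)) * expR (- y) by ring.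
rewrite ey; lra.
Qed.
End scalar_bounds.

Lemma finite_integral_integrable d (T : measurableType d) (R : realType)
    (mu : {measure set T -> \bar R}) (f : T -> R) (c : R) :
  measurable_fun setT f -> (forall x, 0 <= f x) ->
  (\int[mu]_x (f x)%:E = c%:E)%E -> mu.-integrable setT (EFin \o f).
Proof.
move=> mf f0 fc; apply/integrableP; split; first exact/measurable_EFinP.
under eq_integral => x _ do rewrite /= ger0_norm//.
by rewrite fc ltry.
Qed.

(** The shape is that of the majorant in [expRN_le]. Being a [test_function] is demanded explicitly
    because the negative coefficient leaves the sign open. *)
Definition square_exp_comb_tests (R : realType) (v : R) : set ((R -> R) * R) :=
  [set w | exists a b k, [/\ 0 <= a /\ a * v * 2 < 1, 0 <= b /\ b * v * 2 < 1,
     0 <= k,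
     w = (fun x => 2 - expR (a * x ^+ 2) + k * expR (b * x ^+ 2),
          2 - (Num.sqrt (1 - a * v * 2))^-1 + k * (Num.sqrt (1 - b * v * 2))^-1) &
     @test_function R w]].

(** Linearity with a negative coefficient requires integrability, which holds because the rule makes
    each exponential integral finite. *)
Lemma product_rule_square_comb d (T : measurableType d) (R : realType)
    (mu : {measure set T -> \bar R}) (I : finType) (X : I -> T -> R)
    (K0 : T -> R) (q0 v : R) :
  (forall i, measurable_fun setT (X i)) ->
  measurable_fun setT K0 -> (forall w, 0 <= K0 w) -> 0 <= q0 ->
  product_rule mu X K0 q0 (square_exp_tests v) ->
  product_rule mu X K0 q0 (square_exp_comb_tests v).
Proof.
move=> mX mK0 K0_ge0 q0_ge0; apply: (product_rule_extend mX mK0 K0_ge0 q0_ge0).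
- exact: square_exp_tests_test.
- by move=> w [a [b [k []]]].
move=> i K q mK K_ge0 q_ge0 KV _ [a [b [k [[a0 av] [b0 bv] k0 -> _]]]] /=.
have KI s : 0 <= s -> s * v * 2 < 1 ->
    (\int[mu]_w (K w * expR (s * X i w ^+ 2))%:E =
      (q * (Num.sqrt (1 - s * v * 2))^-1)%:E)%E.
  move=> s0 sv; apply: (KV (fun x => expR (s * x ^+ 2), (Num.sqrt (1 - s * v * 2))^-1)).
  by exists s.
have mKs s : measurable_fun setT (fun w => K w * expR (s * X i w ^+ 2)).
  apply: measurable_funM => //; apply: measurableT_comp => //.
  by apply: measurable_funM => //; exact: measurable_funX.
have intK s : 0 <= s -> s * v * 2 < 1 ->
    mu.-integrable setT (fun w => (K w * expR (s * X i w ^+ 2))%:E).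
  move=> s0 sv; apply: (finite_integral_integrable _ _ (KI s s0 sv)) => //.
  by move=> w; rewrite mulr_ge0 ?expR_ge0.
have v0 : 0 * v * 2 < 1 :> R by rewrite !mul0r.
(* The constant 2 is written as twice the exponential with parameter 0, so that [KI] covers it
   too. *)
transitivity (\int[mu]_w ((2%:E * (K w * expR (0 * X i w ^+ 2))%:E -
    (K w * expR (a * X i w ^+ 2))%:E) + k%:E * (K w * expR (b * X i w ^+ 2))%:E))%E.
  apply: eq_integral => w _; rewrite -!EFinM -EFinB -EFinD mul0r expR0.
  by congr (_%:E); ring.
have i0 := intK 0 (lexx _) v0; have ia := intK a a0 av; have ib := intK b b0 bv.
have i2 := integrableZl measurableT 2 i0.
have ibk := integrableZl measurableT k ib.
rewrite (integralD measurableT (integrableB measurableT i2 ia) ibk).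
rewrite (integralB measurableT i2 ia).
rewrite !integralZl// !KI// -!EFinM -EFinB -EFinD !mul0r subr0 sqrtr1 invr1.
by congr (_%:E); ring.
Qed.

(** * Exponential moments of the squared norm of a sketched vector *)

Section gaussian_norm_mgf.
Context (R : realType) (disp : measure_display) (T : measurableType disp).
Context (P : probability T R) (d n : nat).
Context (Phi : 'I_d * 'I_n -> {RV P >-> R}) (F : finType) (S : T -> F) (f : F).
Hypothesis d_gt0 : (0 < d)%N.
Hypothesis iid : iid_gaussian Phi.
Hypotheses (finS : finite_rv S) (SPhi : independent_of_rvs S Phi).
Variables (u : 'cV[R]_n) (lam : R).
Hypotheses (u4 : dotv u u <= 4) (lam_ge0 : 0 <= lam) (lam_le : lam * 32 <= d%:R).

Let K0 (w : T) : R := \1_(S @^-1` [set f]) w.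
Let q0 : R := fine (P (S @^-1` [set f])).

Let K0_ge0 w : 0 <= K0 w. Proof. by rewrite /K0 indicE. Qed.
Let mK0 : measurable_fun setT K0. Proof. exact: measurable_indic. Qed.
Let q0_ge0 : 0 <= q0. Proof. exact: fine_ge0. Qed.

Let X r w : R := (sample_mx Phi w *m u) r 0.
Let Q w := dotv (sample_mx Phi w *m u) (sample_mx Phi w *m u).
Let v := dotv u u / d%:R.

Let N_ge0 : 0 <= dotv u u.
Proof. by apply: sumr_ge0 => i _; rewrite -expr2 sqr_ge0. Qed.

Let d0 : 0 < d%:R :> R. Proof. by rewrite ltr0n. Qed.

Let mX r : measurable_fun setT (X r).
Proof.
rewrite (_ : X r = fun w => \sum_j Phi (r, j) w * u j 0).
  by apply: measurable_sum => j; exact: measurable_funM.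
by apply/funext => w; rewrite /X mxE; apply: eq_bigr => j _; rewrite mxE.
Qed.

Let QE w : Q w = \sum_r X r w ^+ 2.
Proof. by []. Qed.

Lemma measurable_sample_norm : measurable_fun setT Q.
Proof.
rewrite (_ : Q = fun w => \sum_r X r w ^+ 2); last exact/funext.
by apply: measurable_sum => r; exact: measurable_funX.
Qed.

Let square_rule : product_rule P X K0 q0 (square_exp_tests v).
Proof. by apply: product_rule_square => //; exact: product_rule_rows. Qed.

Let v_ge0 : 0 <= v. Proof. by rewrite divr_ge0// ltW. Qed.

(** Keeps the parameter away from 1, where the square moments blow up. *)
Let lam_v : lam * v * 2 <= 1 / 4.
Proof.
rewrite /v; have -> : lam * (dotv u u / d%:R) * 2 = (lam * dotv u u * 2) / d%:R by ring.
rewrite ler_pdivrMr//.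
have : lam * dotv u u <= lam * 4 by rewrite ler_wpM2l.
by move: lam_le; lra.
Qed.

Let upper_mgf : (\int[P]_w (K0 w * expR (lam * (Q w - dotv u u)))%:E <=
  (q0 * expR (8192 * lam ^+ 2 / d%:R))%:E)%E.
Proof.
pose A := (Num.sqrt (1 - lam * v * 2))^-1.
have tA (i : 'I_d) : square_exp_tests v (fun x => expR (lam * x ^+ 2), A).
  by exists lam => //; split => //; move: lam_v; lra.
have := square_rule tA; rewrite prodr_const card_ord /= => H.
rewrite (_ : (\int[P]_w _ = (expR (- (lam * dotv u u)) * (q0 * A ^+ d))%:E)%E); last first.
  rewrite EFinM -H -ge0_integralZl//.
  - apply: eq_integral => w _; rewrite -EFinM mulrBr expRD QE mulr_sumr expR_sum.
    by congr (_%:E); ring.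
  - apply/measurable_EFinP; apply: measurable_funM => //.
    by apply: measurable_prod => r _; exact: (measurableT_comp (measurable_expM2 lam)).
  - by move=> w _; rewrite lee_fin mulr_ge0// prodr_ge0// => r _; rewrite expR_ge0.
rewrite lee_fin mulrCA ler_wpM2l//.
have A_le : A <= expR (lam * v * 2 / 2 + (lam * v * 2) ^+ 2).
  apply: inv_sqrt_le_expR; rewrite !mulr_ge0//=; move: lam_v; lra.
have A0 : 0 <= A by rewrite invr_ge0 sqrtr_ge0.
apply: (@le_trans _ _ (expR (- (lam * dotv u u)) *
   expR (lam * v * 2 / 2 + (lam * v * 2) ^+ 2) ^+ d)).
  by rewrite ler_wpM2l ?expR_ge0// lerXn2r ?nnegrE ?expR_ge0.
rewrite -expRM_natl -expRD ler_expR.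
(* The linear part [d%:R * (lam * v)] is [lam * dotv u u] and cancels the centring. The rest is at
   most [64 * lam ^+ 2 / d%:R]; the larger constant 8192 is dictated by the lower tail. *)
have -> : - (lam * dotv u u) + d%:R * (lam * v * 2 / 2 + (lam * v * 2) ^+ 2) =
    4 * (dotv u u) ^+ 2 * lam ^+ 2 / d%:R.
  by rewrite /v; field; rewrite gt_eqF.
apply: ler_wpM2r; first by rewrite invr_ge0 ltW.
apply: ler_wpM2r; first exact: sqr_ge0.
by move: u4 N_ge0; nra.
Qed.

Let lower_mgf : (\int[P]_w (K0 w * expR (- (lam * (Q w - dotv u u))))%:E <=
  (q0 * expR (8192 * lam ^+ 2 / d%:R))%:E)%E.
Proof.
(* [expRN_le] is used with [y = lam * x ^+ 2] and [z = s0 * x ^+ 2]. The choice [d%:R / 32] gives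
   [s0 * v * 2 <= 1 / 4], so [s0 + lam] stays in the range of [inv_sqrt_le2]. *)
pose s0 : R := d%:R / 32; pose r := lam / s0.
have s0_gt0 : 0 < s0 by rewrite divr_gt0.
have r0 : 0 <= r by rewrite divr_ge0// ltW.
pose A s := (Num.sqrt (1 - s * v * 2))^-1.
pose h x := 2 - expR (lam * x ^+ 2) + 4 * r ^+ 2 * expR ((s0 + lam) * x ^+ 2).
pose c := 2 - A lam + 4 * r ^+ 2 * A (s0 + lam).
have s0v : s0 * v * 2 <= 1 / 4.
  rewrite /s0 /v (_ : _ * 2 = dotv u u / 16); last by field; rewrite gt_eqF.
  by rewrite ler_pdivrMr//; move: u4; lra.
have A2 s : s * v * 2 <= 1 / 2 -> A s <= 2 by exact: inv_sqrt_le2.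
have A_ge0 s : 0 <= A s by rewrite invr_ge0 sqrtr_ge0.
have h_ge x : expR (- (lam * x ^+ 2)) <= h x.
  have := @expRN_le R (lam * x ^+ 2) (s0 * x ^+ 2) r.
  rewrite -mulrDl; apply => //; first by rewrite mulr_ge0 ?sqr_ge0// ltW.
  by rewrite /r mulrA divfK// gt_eqF.
have h0 x : 0 <= h x by apply: le_trans (h_ge x); rewrite expR_ge0.
have mh : measurable_fun [set: R] h.
  apply: measurable_funD; last by apply: measurable_funM => //; exact: measurable_expM2.
  by apply: measurable_funB => //; exact: measurable_expM2.
have c0 : 0 <= c.
  rewrite /c addr_ge0//; last by rewrite mulr_ge0// mulr_ge0// sqr_ge0.
  by rewrite subr_ge0 A2//; move: lam_v; lra.
have rule := product_rule_square_comb mX mK0 K0_ge0 q0_ge0 square_rule.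
have tc (i : 'I_d) : square_exp_comb_tests v (h, c).
  exists lam, (s0 + lam), (4 * r ^+ 2); split => //.
  - by split => //; move: lam_v; lra.
  - by split; [rewrite addr_ge0// ltW|move: lam_v s0v; rewrite !mulrDl; lra].
  - by rewrite mulr_ge0 ?sqr_ge0.
have := rule _ tc; rewrite prodr_const card_ord /= => H.
have mQ := measurable_sample_norm.
apply: (@le_trans _ _ (\int[P]_w ((expR (lam * dotv u u))%:E *
    (K0 w * \prod_i h (X i w))%:E))%E).
  apply: ge0_le_integral => //.
  - by move=> w _; rewrite lee_fin mulr_ge0 ?expR_ge0.
  - apply/measurable_EFinP; apply: measurable_funM => //.
    apply: measurableT_comp => //; apply: measurableT_comp => //.
    by apply: measurable_funM => //; exact: measurable_funB.
  - apply/measurable_EFinP; apply: measurable_funM => //.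
    apply: measurable_funM => //.
    by apply: measurable_prod => i _; exact: measurableT_comp.
  move=> w _; rewrite -EFinM lee_fin mulrCA ler_wpM2l// mulrBr opprB expRD.
  rewrite ler_wpM2l ?expR_ge0// QE mulr_sumr -sumrN expR_sum.
  by apply: ler_prod => i _; rewrite expR_ge0 h_ge.
rewrite ge0_integralZl//; last 2 first.
- apply/measurable_EFinP; apply: measurable_funM => //.
  by apply: measurable_prod => i _; exact: measurableT_comp.
- by move=> w _; rewrite lee_fin mulr_ge0// prodr_ge0.
rewrite H -EFinM lee_fin mulrCA ler_wpM2l//.
(* The term [- (lam * v)] will cancel the centring, and [d%:R * (8 * r ^+ 2)] with
   [r = 32 * lam / d%:R] is exactly [8192 * lam ^+ 2 / d%:R]. *)
have c_le : c <= expR (- (lam * v) + 8 * r ^+ 2).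
  apply: le_trans (expR_ge1Dx _).
  have a1 : 1 + lam * v * 2 / 2 <= A lam.
    by apply: inv_sqrt_ge; rewrite !mulr_ge0//=; move: lam_v; lra.
  have a2 : A (s0 + lam) <= 2.
    by apply: A2; move: lam_v s0v; rewrite !mulrDl; lra.
  have a3 : 4 * r ^+ 2 * A (s0 + lam) <= 4 * r ^+ 2 * 2.
    by rewrite ler_wpM2l// mulr_ge0 ?sqr_ge0.
  by rewrite /c; lra.
apply: (@le_trans _ _ (expR (lam * dotv u u) *
   expR (- (lam * v) + 8 * r ^+ 2) ^+ d)).
  by rewrite ler_wpM2l ?expR_ge0// lerXn2r ?nnegrE ?expR_ge0.
rewrite -expRM_natl -expRD ler_expR /v /r /s0.
by rewrite le_eqVlt; apply/orP; left; apply/eqP; field; rewrite gt_eqF.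
Qed.

Lemma gaussian_norm_mgf :
  (\int[P]_w (K0 w * (expR (lam * (Q w - dotv u u)) +
                      expR (- (lam * (Q w - dotv u u)))))%:E <=
   (q0 * (2 * expR (8192 * lam ^+ 2 / d%:R)))%:E)%E.
Proof.
have mQ := measurable_sample_norm.
have mE : measurable_fun setT (fun w => lam * (Q w - dotv u u)).
  by apply: measurable_funM => //; exact: measurable_funB.
under eq_integral do rewrite mulrDr EFinD.
rewrite ge0_integralD//.
- by rewrite mulr_natl mulr2n mulrDr EFinD leeD// ?upper_mgf ?lower_mgf.
- by move=> w _; rewrite lee_fin mulr_ge0 ?expR_ge0.
- by apply/measurable_EFinP; apply: measurable_funM => //; exact: measurableT_comp.
- by move=> w _; rewrite lee_fin mulr_ge0 ?expR_ge0.
- apply/measurable_EFinP; apply: measurable_funM => //.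
  by apply: measurableT_comp => //; exact: measurableT_comp.
Qed.

End gaussian_norm_mgf.

(** * Sampling without replacement *)

Section rank_probabilities.
Context (R : realType) (m n : nat).
Hypotheses (n_gt0 : (0 < n)%N) (n_le_m : (n <= m)%N).

(** One formula serves both branches, since the binomial coefficient vanishes on the second. *)
Lemma rank_probE j : (j < m)%N ->
  rank_prob R m n j.+1 = 'C(m - j.+1, n.-1)%:R / 'C(m, n)%:R.
Proof.
move=> ltjm; rewrite /rank_prob subn1; case: leqP => // jm.
by rewrite bin_small ?mul0r//; lia.
Qed.

Lemma bin_neq0 : 'C(m, n)%:R != 0 :> R.
Proof. by rewrite pnatr_eq0 -lt0n bin_gt0. Qed.

(** Pascal's rule as a difference, so that the probabilities telescope. *)
Lemma bin_pascal_sub j : (j < m)%N ->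
  'C(m - j.+1, n.-1)%:R = 'C(m - j, n)%:R - 'C(m - j.+1, n)%:R :> R.
Proof.
move=> jm; apply/eqP; rewrite eq_sym subr_eq -natrD eqr_nat.
by rewrite -(prednK n_gt0) -[in X in X == _](subnSK jm) binS addnC.
Qed.

Lemma sum_rank_prob : \sum_(1 <= j < m.+1) rank_prob R m n j = 1.
Proof.
rewrite big_add1 /= big_nat.
under eq_bigr => j /andP[_ jm] do rewrite rank_probE// bin_pascal_sub// -opprB.
rewrite -big_nat -mulr_suml sumrN telescope_sumr//.
by rewrite subnn subn0 bin0n (gtn_eqF n_gt0) sub0r opprK divff// bin_neq0.
Qed.

Lemma rank_prob_ge0 j : 0 <= rank_prob R m n j.
Proof. by rewrite /rank_prob; case: ifP. Qed.

Lemma rank_prob_noninc i j : (1 <= i <= j)%N -> (j <= m)%N ->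
  rank_prob R m n j <= rank_prob R m n i.
Proof.
case: i => // i; case: j => // j /andP[_ ij] jm.
rewrite !rank_probE ?(leq_trans ij)//.
by rewrite ler_wpM2r ?invr_ge0// ler_nat; apply: leq_bin2l; lia.
Qed.

(** For [n = 1] every rank has probability [1 / m], whence the strict hypothesis. *)
Lemma rank_prob_last : (1 < n)%N -> rank_prob R m n m = 0.
Proof. by move=> n1; rewrite /rank_prob ifF//; apply/negbTE; lia. Qed.

(* [r f] is the smallest rank of a chosen row, ranks being 0-based. *)
Lemma sum_min_rank (s : {perm 'I_m}) (r : {ffun 'I_n -> 'I_m} -> 'I_m)
    (g : 'I_m -> R) :
  (forall f, (forall k, r f <= (s^-1)%g (f k))%N /\
             exists k, r f = (s^-1)%g (f k)) ->
  (\sum_(f : {ffun 'I_n -> 'I_m} | injectiveb f) g (r f)) / (m ^_ n)%:R =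
  \sum_(j < m) rank_prob R m n j.+1 * g j.
Proof.
move=> rP; rewrite (partition_big r predT)//= mulr_suml.
(* Smallest rank at least [j] means an injection into the [m - j] rows of rank at least [j];
   smallest rank exactly [j] is then counted by a difference. *)
pose N j := #|[set f : {ffun 'I_n -> 'I_m} | injectiveb f & (j <= r f)%N]%SET|.
have NE j : N j = (m - j) ^_ n.
  pose D := [set i : 'I_m | (j <= (s^-1)%g i)%N]%SET.
  have cD : #|D| = (m - j)%N.
    transitivity #|[set i : 'I_m | (j <= i)%N]%SET|.
      rewrite -(card_preimset [set i : 'I_m | (j <= i)%N]%SET (@perm_inj _ s^-1%g)).
      by apply: eq_card => i; rewrite !inE.
    rewrite cardsE -sum1_card.
    by rewrite -(big_geq_mkord j m xpredT (fun=> 1%N)) sum_nat_const_nat muln1.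
  rewrite -cD -[n in RHS]card_ord -card_inj_ffuns_on.
  apply: eq_card => f; rewrite !inE andbC; congr (_ && _).
  have [rf [k rk]] := rP f.
  apply/idP/ffun_onP => [jr i|fD]; first by rewrite inE (leq_trans jr).
  by rewrite rk; have := fD k; rewrite inE.
have NB (j : 'I_m) : #|[pred f : {ffun 'I_n -> 'I_m} | injectiveb f && (r f == j)]|
    = (N j - N j.+1)%N.
  rewrite /N -cardsDS.
    apply: eq_card => f; rewrite !inE negb_and -leqNgt.
    by case: (injectiveb f); rewrite ?andbF//= -val_eqE eqn_leq.
  by apply/fintype.subsetP => f; rewrite !inE => /andP[-> /ltnW].
apply: eq_bigr => j _.
under eq_bigr => f /andP[_ /eqP ->] do idtac.
rewrite sumr_const NB !NE -[X in X / _]mulr_natl mulrAC; congr (_ * _).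
have lejn : ((m - j.+1) ^_ n <= (m - j) ^_ n)%N.
  by rewrite -!bin_ffact leq_mul2r leq_bin2l ?orbT//; lia.
rewrite natrB// -!bin_ffact !natrM -mulrBl -bin_pascal_sub// rank_probE//.
by rewrite invfM mulrACA mulfV ?mulr1// pnatr_eq0 -lt0n fact_gt0.
Qed.

(** Swapping two rows permutes the injections, so all rows are equally frequent at position [k]. *)
Lemma sum_inj_component (k : 'I_n) (g : 'I_m -> R) :
  (\sum_(f : {ffun 'I_n -> 'I_m} | injectiveb f) g (f k)) / (m ^_ n)%:R =
  m%:R^-1 * \sum_i g i.
Proof.
pose N i := #|[pred f : {ffun 'I_n -> 'I_m} | injectiveb f && (f k == i)]|.
have NC i j : N i = N j.
  pose h (f : {ffun 'I_n -> 'I_m}) := [ffun l => tperm i j (f l)].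
  have hh : involutive h by move=> f; apply/ffunP => l; rewrite !ffunE tpermK.
  rewrite /N -!sum1_card (reindex_inj (inv_inj hh)) /=; apply: eq_bigl => f.
  rewrite !inE; congr (_ && _).
    apply/injectiveP/injectiveP => inj a b.
      by move=> ab; apply: inj; rewrite !ffunE ab.
    by rewrite !ffunE => /perm_inj/inj.
  by rewrite ffunE -{2}(tpermR i j) (inj_eq perm_inj).
have m_gt0 : (0 < m)%N by exact: leq_trans n_le_m.
pose i0 : 'I_m := Ordinal m_gt0.
have sumN (h : 'I_m -> R) :
    \sum_(f : {ffun 'I_n -> 'I_m} | injectiveb f) h (f k) =
    (N i0)%:R * \sum_i h i.
  rewrite (partition_big (fun f : {ffun 'I_n -> 'I_m} => f k) predT)//= mulr_sumr.
  apply: eq_bigr => i _; rewrite (NC i0 i) mulr_natl -sumr_const.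
  by apply: eq_bigr => f /andP[_ /eqP ->].
(* The constant function 1 determines the common frequency. *)
have := sumN (fun=> 1); rewrite sumr_const -cardsE card_inj_ffuns !card_ord.
rewrite sumr_const card_ord => tot; rewrite sumN tot.
have mR : m%:R != 0 :> R by rewrite pnatr_eq0 -lt0n.
have : (m ^_ n)%:R != 0 :> R by rewrite pnatr_eq0 -lt0n ffact_gt0.
rewrite tot mulf_eq0 negb_or => /andP[NR _].
by field; rewrite NR mR.
Qed.
End rank_probabilities.

(** * One iteration of RKJL *)

Section geometry.
Context (R : realType).

Lemma dotvC n (u v : 'cV[R]_n) : dotv u v = dotv v u.
Proof. by apply: eq_bigr => i _; rewrite mulrC. Qed.

Lemma dotvDl n (u v w : 'cV[R]_n) : dotv (u + v) w = dotv u w + dotv v w.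
Proof. by rewrite -big_split; apply: eq_bigr => i _; rewrite mxE mulrDl. Qed.

Lemma dotvZl n (t : R) (u v : 'cV[R]_n) : dotv (t *: u) v = t * dotv u v.
Proof. by rewrite mulr_sumr; apply: eq_bigr => i _; rewrite mxE mulrA. Qed.

Lemma dotv_sqrD n (u v : 'cV[R]_n) (t : R) :
  dotv (u + t *: v) (u + t *: v) = dotv u u + 2 * t * dotv u v + t ^+ 2 * dotv v v.
Proof.
rewrite dotvDl dotvZl !(dotvC _ (u + _)) !dotvDl !dotvZl (dotvC v u); ring.
Qed.

Lemma dotv_ge0 n (u : 'cV[R]_n) : 0 <= dotv u u.
Proof. by apply: sumr_ge0 => i _; rewrite -expr2 sqr_ge0. Qed.

Lemma norm2_sqr n (u : 'cV[R]_n) : norm2 u ^+ 2 = dotv u u.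
Proof. by rewrite sqr_sqrtr// dotv_ge0. Qed.

Lemma unit_dotv_le1 n (a x : 'cV[R]_n) :
  dotv a a = 1 -> dotv x x <= 1 -> `|dotv a x| <= 1.
Proof.
move=> a1 x1; have := dotv_ge0 (a + 1 *: x); have := dotv_ge0 (a + (-1) *: x).
by rewrite !dotv_sqrD a1 ler_norml; lra.
Qed.

Lemma norm2_project m n (A : 'M[R]_(m, n)) (x : 'cV[R]_n) (i : 'I_m) :
  norm2 (arow A i) = 1 ->
  norm2 (project A x i) ^+ 2 = dotv x x - dotv (arow A i) x ^+ 2.
Proof.
move=> a1; have aa : dotv (arow A i) (arow A i) = 1 by rewrite -norm2_sqr a1 expr1n.
by rewrite norm2_sqr /project -scaleNr dotv_sqrD aa (dotvC x); ring.
Qed.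

(** The values 0, 1, 2 of [e] yield [a - x], [a] and [a + x]. *)
Definition probe n (a x : 'cV[R]_n) (e : 'I_3) : 'cV[R]_n := a + (e%:R - 1) *: x.

Lemma probe_le4 n (a x : 'cV[R]_n) (e : 'I_3) :
  dotv a a = 1 -> dotv x x <= 1 -> dotv (probe a x e) (probe a x e) <= 4.
Proof.
move=> a1 x1; rewrite dotv_sqrD a1.
have := unit_dotv_le1 a1 x1; rewrite ler_norml => /andP[b1 b2].
by case: e => [[|[|[|e]]] ?] //=; have := dotv_ge0 x; lra.
Qed.

(* Polarization: the distortion of the three probes controls the one of the
   inner product and of the norm of [a]. *)
Lemma gamma_dist d n (M : 'M[R]_(d, n)) (a x : 'cV[R]_n) (q : R) :
  dotv a a = 1 -> dotv x x <= 1 -> q <= 3 / 4 ->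
  (forall e, `|dotv (M *m probe a x e) (M *m probe a x e)
               - dotv (probe a x e) (probe a x e)| <= q) ->
  `| `|dotv (M *m a) (M *m x)| / norm2 (M *m a) - `|dotv a x| | <= 3 * q.
Proof.
move=> a1 x1 q34 Mq.
have := Mq ord_max; have := Mq ord0; have := Mq (inord 1).
rewrite /probe inordK//= subrr scale0r addr0 a1.
rewrite !mulmxDr -!scalemxAr !dotv_sqrD a1 -norm2_sqr.
set r := norm2 (M *m a); set b := dotv (M *m a) (M *m x); set c := dotv a x.
have r0 : 0 <= r by rewrite sqrtr_ge0.
have c1 : `|c| <= 1 by exact: unit_dotv_le1.
rewrite !ler_norml => /andP[r1 r2] /andP[m1 m2] /andP[p1 p2].
have q0 : 0 <= q by lra.
(* As [q <= 3 / 4], the sketched norm [r] is at least 1/2. The numerator contributes an error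
   [q / 2] by polarization, the norm an error [q], and dividing by [r] at most doubles the sum,
   whence [3 * q]. *)
have r12 : 1 / 2 <= r by nra.
have rq1 : r - 1 <= q by nra.
have rq2 : 1 - r <= q by nra.
have bc : `|b - c| <= q / 2 by rewrite ler_norml; apply/andP; split; lra.
have bc1 : `|b| - `|c| <= q / 2 by apply: le_trans (lerB_dist _ _) bc.
have bc2 : `|c| - `|b| <= q / 2 by apply: le_trans (lerB_dist _ _) _; rewrite distrC.
have rp : 0 < r by lra.
have c0 := normr_ge0 c.
apply/andP; split.
  rewrite lerBrDr addrC ler_pdivlMr//; nra.
rewrite lerBlDr ler_pdivrMr//; nra.
Qed.

(** [gamma_dist] for row [f k] and for the winner costs [6 * q] on absolute values; squaring costs a
    further factor 2, both inner products being at most 1 in absolute value. *)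
Lemma select_gap d m n (A : 'M[R]_(m, n)) (M : 'M[R]_(d, n)) (x : 'cV[R]_n)
    (f : 'I_n -> 'I_m) (j : 'I_m) (k : 'I_n) (q : R) :
  (forall i, norm2 (arow A i) = 1) -> norm2 x <= 1 ->
  rkjl_select A M x f j ->
  (forall l e, `|dotv (M *m probe (arow A (f l)) x e) (M *m probe (arow A (f l)) x e)
     - dotv (probe (arow A (f l)) x e) (probe (arow A (f l)) x e)| <= q) ->
  dotv (arow A (f k)) x ^+ 2 - dotv (arow A j) x ^+ 2 <= 12 * q.
Proof.
move=> A1 x1 [[l ->] jmax] Mq.
have a1 i : dotv (arow A i) (arow A i) = 1 by rewrite -norm2_sqr A1 expr1n.
have xx1 : dotv x x <= 1 by rewrite -norm2_sqr expr_le1// sqrtr_ge0.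
have bk := unit_dotv_le1 (a1 (f k)) xx1; have bl := unit_dotv_le1 (a1 (f l)) xx1.
rewrite -[X in X - _]real_normK ?num_real// -[X in _ - X]real_normK ?num_real//.
have q0 : 0 <= q by apply: le_trans (Mq l ord0).
have nk := normr_ge0 (dotv (arow A (f k)) x).
have nl := normr_ge0 (dotv (arow A (f l)) x).
(* For [q] above 3/4 the claim is trivial, its left-hand side being at most 1. *)
have [q34|q34] := leP q (3 / 4); last by nra.
have := jmax k; rewrite /rkjl_gamma.
have := gamma_dist (a1 (f k)) xx1 q34 (Mq k).
have := gamma_dist (a1 (f l)) xx1 q34 (Mq l).
rewrite !ler_norml => /andP[_ g1] /andP[g2 _] g3.
have : `|dotv (arow A (f k)) x| - `|dotv (arow A (f l)) x| <= 6 * q by lra.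
nra.
Qed.

Lemma test_ge m n (A : 'M[R]_(m, n)) (x : 'cV[R]_n) (l j : 'I_m) :
  dotv (arow A l) x ^+ 2 <= dotv (arow A (rkjl_test A x l j)) x ^+ 2 /\
  dotv (arow A j) x ^+ 2 <= dotv (arow A (rkjl_test A x l j)) x ^+ 2.
Proof.
have sqE i : dotv (arow A i) x ^+ 2 = `|dotv (arow A i) x| ^+ 2.
  by rewrite real_normK ?num_real.
have sq_le i k : `|dotv (arow A i) x| <= `|dotv (arow A k) x| ->
    dotv (arow A i) x ^+ 2 <= dotv (arow A k) x ^+ 2.
  by move=> ik; rewrite !sqE lerXn2r ?nnegrE.
by rewrite /rkjl_test; case: ltP => jl; split => //; apply: sq_le => //; exact: ltW.
Qed.
End geometry.

(** * Expectations of finite-valued random variables *)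

Section finite_rv.
Context (R : realType) (disp : measure_display) (T : measurableType disp).
Context (P : probability T R).

Lemma finite_rv_comp (F G : finType) (X : T -> F) (h : F -> G) :
  finite_rv X -> finite_rv (fun w => h (X w)).
Proof.
move=> mX g.
rewrite (_ : _ @^-1` _ = \bigcup_(f in [set f | h f = g]) (X @^-1` [set f])).
  by apply: fin_bigcup_measurable => // f _; exact: mX.
by apply/seteqP; split => [w /= hg|w [f /= hg] /= ->//]; by exists (X w).
Qed.

Lemma finite_rv_pair (F G : finType) (X : T -> F) (Y : T -> G) :
  finite_rv X -> finite_rv Y -> finite_rv (fun w => (X w, Y w)).
Proof.
move=> mX mY [f g].
rewrite (_ : _ @^-1` _ = X @^-1` [set f] `&` Y @^-1` [set g]).
  by apply: measurableI; [exact: mX|exact: mY].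
apply/seteqP; split => w /=; first by move=> [-> ->].
by move=> [-> ->].
Qed.

Context (F : finType) (X : T -> F).
Hypothesis mX : finite_rv X.

Lemma finite_rvE (g : F -> R) w : g (X w) = \sum_f g f * \1_(X @^-1` [set f]) w.
Proof.
rewrite (bigD1 (X w))//= indicE mem_set// mulr1 big1 ?addr0// => f /eqP fX.
by rewrite indicE memNset ?mulr0// => /= /esym.
Qed.

Let iX f : P.-integrable setT (fun w => (\1_(X @^-1` [set f]) w : R)%:E).
Proof.
apply: (@finite_integral_integrable _ _ _ _ _ (fine (P (X @^-1` [set f])))).
- by apply: measurable_indic; exact: mX.
- by move=> w; rewrite indicE.
- rewrite integral_indic//.
  by rewrite setIT fineK// fin_num_measure.
Qed.

Lemma finite_rv_integrable (g : F -> R) :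
  P.-integrable setT (fun w => (g (X w))%:E).
Proof.
rewrite (_ : (fun w => _) =
    fun w => (\sum_f (g f)%:E * (\1_(X @^-1` [set f]) w)%:E)%E).
  by apply: integrable_sum => // f _; apply: integrableZl.
by apply/funext => w; rewrite finite_rvE -sumEFin; apply: eq_bigr => f _; rewrite EFinM.
Qed.

Lemma finite_rv_integral (g : F -> R) :
  (\int[P]_w (g (X w))%:E = (\sum_f g f * fine (P (X @^-1` [set f])))%:E)%E.
Proof.
transitivity (\int[P]_w (\sum_f (g f)%:E * (\1_(X @^-1` [set f]) w)%:E))%E.
  apply: eq_integral => w _; rewrite finite_rvE -sumEFin.
  by apply: eq_bigr => f _; rewrite EFinM.
rewrite integral_sum//; last by move=> f; exact: integrableZl.
rewrite -sumEFin; apply: eq_bigr => f _.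
rewrite integralZl// integral_indic// setIT.
by rewrite EFinM fineK// fin_num_measure.
Qed.

Lemma finite_rv_measurable (g : F -> R) : measurable_fun setT (fun w => g (X w)).
Proof. by have /measurable_int/measurable_EFinP := finite_rv_integrable g. Qed.

Lemma sum_finite_rv : \sum_f fine (P (X @^-1` [set f])) = 1.
Proof.
have e1 : (\int[P]_w 1%:E = 1%:E)%E.
  by rewrite integral_cst// mul1e; exact: probability_setT.
have := finite_rv_integral (fun=> 1); rewrite e1.
by move=> [->]; apply: eq_bigr => f _; rewrite mul1r.
Qed.

End finite_rv.

Lemma integral_without_replacement (R : realType) (disp : measure_display)
    (T : measurableType disp) (P : probability T R) (m n : nat)
    (S : T -> {ffun 'I_n -> 'I_m}) (g : {ffun 'I_n -> 'I_m} -> R) :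
  without_replacement P S ->
  (\int[P]_w (g (S w))%:E =
   ((\sum_(f : {ffun 'I_n -> 'I_m} | injectiveb f) g f) / (m ^_ n)%:R)%:E)%E.
Proof.
move=> [mS injS PS]; rewrite finite_rv_integral// [X in X / _]big_mkcond mulr_suml.
congr (_%:E); apply: eq_bigr => f _; case: ifPn => [/injectiveP/PS -> //|ninj].
rewrite (_ : S @^-1` [set f] = set0) ?measure0 ?mulr0 ?mul0r//.
by apply/seteqP; split => // w /= Sf; case/negP: ninj; apply/injectiveP; rewrite -Sf.
Qed.

(** The tangent line of the exponential at [ln c]. It will turn a bound [c] on an exponential moment
    into one on an expectation. *)
Lemma le_expR_ln (R : realType) (c z : R) : 0 < c -> z <= expR z / c + (ln c - 1).
Proof.
move=> c0; have := expR_ge1Dx (z - ln c).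
by rewrite expRB lnK ?posrE//; lra.
Qed.

Lemma expR_norm_le (R : realType) (z : R) : expR `|z| <= expR z + expR (- z).
Proof.
by case: (ger0P z) => _; rewrite ?lerDl ?lerDr expR_ge0.
Qed.

(** The lower bound reduces to [expR 1 <= 4], the upper one to [6 <= n%:R ^+ 3], true from [n = 2]
    on. *)
Lemma ln6n2_bounds (R : realType) (n : nat) : (1 < n)%N ->
  1 <= ln (6 * n%:R ^+ 2 : R) <= 5 * ln (n%:R : R).
Proof.
move=> n1; have n0 : 0 < n%:R :> R by rewrite ltr0n ltnW.
have n2 : 2 <= n%:R :> R by rewrite ler_nat.
have n6 : 4 <= 6 * n%:R ^+ 2 :> R by nra.
apply/andP; split.
  rewrite -[X in X <= _]expRK ler_ln ?posrE ?expR_gt0//; last by lra.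
  apply: le_trans n6.
  have h : 1 / 2 <= expR (- (1 / 2)) :> R by have := expR_ge1Dx (- (1 / 2) : R); lra.
  have e : expR 1 * (expR (- (1 / 2)) * expR (- (1 / 2))) = 1 :> R.
    by rewrite -!expRD -[RHS]expR0; congr expR; field.
  move: (expR (- (1 / 2))) h e => w h; have := expR_ge0 (1 : R).
  move: (expR 1) => z z0; have : z * (1 / 4) <= z * (w * w) by rewrite ler_wpM2l//; nra.
  lra.
have -> : 5 * ln n%:R = ln (n%:R ^+ 5) :> R by rewrite lnXn// mulr_natl.
rewrite ler_ln ?posrE ?exprn_gt0//; last by lra.
have -> : n%:R ^+ 5 = n%:R ^+ 3 * n%:R ^+ 2 :> R by rewrite -exprD.
rewrite ler_wpM2r ?sqr_ge0//.
have -> : n%:R ^+ 3 = n%:R * n%:R * n%:R :> R by ring.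
nra.
Qed.

(** * Expected loss of the sketched selection *)

Section shortfall.
Context (R : realType) (disp : measure_display) (T : measurableType disp).
Context (P : probability T R) (d m n : nat) (A : 'M[R]_(m, n)) (x : 'cV[R]_n).
Context (Phi : 'I_d * 'I_n -> {RV P >-> R}) (S : T -> {ffun 'I_n -> 'I_m}).
Context (J : T -> 'I_m).
Hypotheses (A1 : forall i, norm2 (arow A i) = 1) (x1 : norm2 x <= 1).
Hypothesis iid : iid_gaussian Phi.
Hypotheses (finS : finite_rv S) (SPhi : independent_of_rvs S Phi).
Hypothesis selJ : forall w, rkjl_select A (sample_mx Phi w) x (S w) (J w).
Variable delta : R.
Hypotheses (d_gt0 : (0 < d)%N) (n_gt1 : (1 < n)%N) (delta_gt0 : 0 < delta).
Hypothesis dE : d%:R = (8192 * 900) * delta ^- 2 * ln n%:R :> R.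

Let c i := dotv (arow A i) x ^+ 2.

Let a1 i : dotv (arow A i) (arow A i) = 1.
Proof. by rewrite -norm2_sqr A1 expr1n. Qed.

Let x2 : dotv x x <= 1.
Proof. by rewrite -norm2_sqr expr_le1// sqrtr_ge0. Qed.

Variables (best : {ffun 'I_n -> 'I_m} -> 'I_m) (K : T -> 'I_m).
Hypothesis best_in : forall f, exists k, best f = f k.
Hypothesis best_max : forall (f : {ffun 'I_n -> 'I_m}) k, c (f k) <= c (best f).
Hypothesis K_in : forall w, exists k, K w = S w k.
Hypothesis JK : forall w, c (J w) <= c (K w).
Hypothesis finK : finite_rv K.

Let D w := c (best (S w)) - c (K w).

Let D_ge0 w : 0 <= D w.
Proof. by rewrite subr_ge0; have [k ->] := K_in w. Qed.

Let c_le1 i : c i <= 1.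
Proof.
have := unit_dotv_le1 (a1 i) x2; rewrite ler_norml /c => /andP[? ?]; nra.
Qed.

Let mD : measurable_fun setT D.
Proof.
apply: measurable_funB; last exact: (finite_rv_measurable P finK).
exact: (finite_rv_measurable P finS (fun f => c (best f))).
Qed.

Let Q i e w := dotv (sample_mx Phi w *m probe (arow A i) x e)
                    (sample_mx Phi w *m probe (arow A i) x e)
               - dotv (probe (arow A i) x e) (probe (arow A i) x e).

Let lam := 30 * ln n%:R / delta.
Let E i e w := expR (lam * Q i e w) + expR (- (lam * Q i e w)).
Let W w := \sum_k \sum_e E (S w k) e w.
(** There are [3 * n] probes, each with a two-sided exponential moment of at most [2 * n%:R]. *)
Let M : R := 6 * n%:R ^+ 2.

Let n0 : 0 < n%:R :> R. Proof. by rewrite ltr0n ltnW. Qed.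
Let ln_gt0 : 0 < ln n%:R :> R. Proof. by rewrite ln_gt0// ltr1n. Qed.
Let lam_gt0 : 0 < lam. Proof. by rewrite divr_gt0// mulr_gt0. Qed.
Let M_gt0 : 0 < M. Proof. by rewrite mulr_gt0// exprn_gt0. Qed.
Let E_ge0 i e w : 0 <= E i e w. Proof. by rewrite addr_ge0// expR_ge0. Qed.
Let W_ge0 w : 0 <= W w. Proof. by rewrite sumr_ge0// => k _; rewrite sumr_ge0. Qed.

(** This explains the constant in [dE]: 8192 comes from [gaussian_norm_mgf], and 900 is the square
    of the 30 in [lam]. *)
Let lam2d : expR (8192 * lam ^+ 2 / d%:R) = n%:R.
Proof.
rewrite dE -[RHS]lnK ?posrE//; congr expR; rewrite /lam.
by field; rewrite !gt_eqF.
Qed.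

Let mE i e : measurable_fun setT (E i e).
Proof.
have mQ : measurable_fun setT (fun w => lam * Q i e w).
  apply: measurable_funM => //; apply: measurable_funB => //.
  exact: measurable_sample_norm.
apply: measurable_funD; first exact: measurableT_comp.
by apply: measurableT_comp => //; exact: measurableT_comp.
Qed.

(** The probed rows depend on the random tuple. Splitting over its values leaves fixed vectors,
    weighted by the indicators allowed in [gaussian_norm_mgf]. *)
Let WE w : W w = \sum_f \1_(S @^-1` [set f]) w * \sum_k \sum_e E (f k) e w.
Proof.
rewrite (bigD1 (S w))//= indicE mem_set// mul1r [X in _ + X]big1 ?addr0// => f /eqP fS.
by rewrite indicE memNset ?mul0r// => /= /esym.
Qed.

Let mW : measurable_fun setT W.
Proof.
rewrite (_ : W = fun w => \sum_f \1_(S @^-1` [set f]) w * \sum_k \sum_e E (f k) e w);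
  last exact/funext.
apply: measurable_sum => f; apply: measurable_funM.
  by apply: measurable_indic; exact: finS.
by apply: measurable_sum => k; exact: measurable_sum.
Qed.

Let integral_W : delta <= 1 -> (\int[P]_w (W w)%:E <= M%:E)%E.
Proof.
move=> delta1.
(* This is where [delta <= 1] is used: [960 * delta] stays below the constant of [dE]. *)
have lam_d : lam * 32 <= d%:R.
  rewrite dE /lam.
  have -> : 30 * ln n%:R / delta * 32 = (960 * delta) * (delta ^- 2 * ln n%:R) :> R.
    by field; rewrite gt_eqF.
  rewrite -[X in _ <= X]mulrA; apply: ler_wpM2r; last lra.
  by rewrite mulr_ge0 ?invr_ge0 ?exprn_ge0// ltW.
pose F f k e w := \1_(S @^-1` [set f]) w * E (f k) e w.
have F_ge0 f k e w : 0 <= F f k e w by rewrite mulr_ge0// indicE.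
have mF f k e : measurable_fun setT (F f k e).
  by apply: measurable_funM => //; apply: measurable_indic; exact: finS.
have FE w : (W w)%:E = (\sum_f \sum_k \sum_e (F f k e w)%:E)%E.
  rewrite WE -sumEFin; apply: eq_bigr => f _.
  rewrite mulr_sumr -sumEFin; apply: eq_bigr => k _.
  by rewrite mulr_sumr -sumEFin.
under eq_integral do rewrite FE.
have mEF f k e : measurable_fun setT (fun w => (F f k e w)%:E).
  exact/measurable_EFinP.
rewrite ge0_integral_sum//; last 2 first.
- by move=> f; do 2 (apply: emeasurable_sum => ?).
- by move=> f w _; do 2 (apply: sume_ge0 => ? _); rewrite lee_fin.
pose p f := fine (P (S @^-1` [set f])).
have bound f : (\int[P]_w (\sum_k \sum_e (F f k e w)%:E) <= (p f * M)%:E)%E.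
  rewrite ge0_integral_sum//; last 2 first.
  - by move=> k; apply: emeasurable_sum.
  - by move=> k w _; apply: sume_ge0 => e _; rewrite lee_fin.
  apply: (@le_trans _ _ (\sum_(k < n) \sum_(e < 3) (p f * (2 * n%:R))%:E)%E).
    apply: lee_sum => k _; rewrite ge0_integral_sum//; last first.
      by move=> e w _; rewrite lee_fin.
    apply: lee_sum => e _; rewrite -lam2d.
    apply: gaussian_norm_mgf => //; last exact: ltW.
    exact: probe_le4.
  under eq_bigr do rewrite sumEFin sumr_const card_ord.
  rewrite sumEFin sumr_const card_ord lee_fin.
  rewrite le_eqVlt; apply/orP; left; apply/eqP; rewrite /M.
  rewrite -[X in X = _]mulr_natr -[X in X * _ = _]mulr_natr; ring.
apply: le_trans (lee_sum _ (fun f _ => bound f)) _.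
by rewrite sumEFin -mulr_suml sum_finite_rv// mul1r.
Qed.

Let D_le w : D w <= 12 * ((ln M - 1) / lam) + 12 / (lam * M) * W w.
Proof.
have -> : 12 * ((ln M - 1) / lam) + 12 / (lam * M) * W w =
    12 * ((W w / M + (ln M - 1)) / lam).
  by field; rewrite !gt_eqF.
have [k bk] := best_in (S w).
apply: (@le_trans _ _ (c (S w k) - c (J w))); first by rewrite /D bk lerB.
(* The distortion bound is [(W w / M + (ln M - 1)) / lam]: it follows from [le_expR_ln], because
   [W w] dominates each single exponential. *)
apply: (select_gap _ A1 x1 (selJ w)) => l e.
rewrite ler_pdivlMr// mulrC -[X in X * _](gtr0_norm lam_gt0) -normrM.
apply: le_trans (le_expR_ln _ M_gt0) _; rewrite lerD2r ler_wpM2r ?invr_ge0 ?(ltW M_gt0)//.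
apply: le_trans (expR_norm_le _) _.
rewrite /W (bigD1 l)//= (bigD1 e)//= -addrA lerDl addr_ge0// sumr_ge0// => i _.
by rewrite sumr_ge0.
Qed.

Lemma expected_shortfall : (\int[P]_w (D w)%:E <= (2 * delta)%:E)%E.
Proof.
(* For [delta > 1] the bound [D w <= 1] suffices. *)
have [delta1|delta1] := leP delta 1; last first.
  apply: (@le_trans _ _ (\int[P]_w 1%:E)%E).
    apply: ge0_le_integral => //.
    - by move=> w _; rewrite lee_fin.
    - exact/measurable_EFinP.
    move=> w _; rewrite lee_fin.
    have := c_le1 (best (S w)); have : 0 <= c (K w) by exact: sqr_ge0.
    by rewrite /D; lra.
  rewrite integral_cst// mul1e; apply: le_trans (probability_le1 _ _) _ => //.
  by rewrite lee_fin; lra.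
have /andP[M1 M5] := ln6n2_bounds R n_gt1; rewrite -/M in M1 M5.
have c0 : 0 <= 12 * ((ln M - 1) / lam) by rewrite mulr_ge0// divr_ge0// ?subr_ge0// ltW.
have c1 : 0 <= 12 / (lam * M) by rewrite divr_ge0// mulr_ge0// ltW.
apply: (@le_trans _ _ (\int[P]_w ((12 * ((ln M - 1) / lam))%:E +
    (12 / (lam * M))%:E * (W w)%:E))%E).
  apply: ge0_le_integral => //.
  - by move=> w _; rewrite lee_fin.
  - exact/measurable_EFinP.
  - by apply: emeasurable_funD => //; apply: measurable_funeM; exact/measurable_EFinP.
  by move=> w _; rewrite -EFinM -EFinD lee_fin.
have mEW : measurable_fun setT (fun w => (W w)%:E) by exact/measurable_EFinP.
rewrite ge0_integralD//; last 2 first.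
- by move=> w _; rewrite mule_ge0 ?lee_fin.
- exact: measurable_funeM.
have e1 (t : R) : (\int[P]_w t%:E = t%:E)%E.
  rewrite integral_cst// -[RHS]mule1; congr (_ * _)%E; exact: probability_setT.
rewrite e1 ge0_integralZl//; last by move=> w _; rewrite lee_fin.
apply: (@le_trans _ _ ((12 * ((ln M - 1) / lam))%:E + (12 / (lam * M))%:E * M%:E)%E).
  by rewrite leeD2l// lee_wpmul2l ?lee_fin ?integral_W.
rewrite -EFinM -EFinD lee_fin.
(* The terms without logarithm cancel. As [ln M <= 5 * ln n%:R], the factor 30 in [lam] leaves
   [60 / 30 = 2] times [delta]. *)
have -> : 12 * ((ln M - 1) / lam) + 12 / (lam * M) * M = 12 * ln M / lam.
  by field; rewrite !gt_eqF.
rewrite ler_pdivrMr// /lam.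
have -> : 2 * delta * (30 * ln n%:R / delta) = 60 * ln n%:R :> R.
  by field; rewrite gt_eqF.
lra.
Qed.

End shortfall.

(** * Comparison of RKJL with RK *)

Lemma rk_expectation (R : realType) (disp : measure_display)
    (T : measurableType disp) (P : probability T R) (m n : nat)
    (A : 'M[R]_(m, n)) (x : 'cV[R]_n) (y : T -> 'cV[R]_n) :
  (0 < m)%N -> (forall i, norm2 (arow A i) = 1) -> rk_iteration P A x y ->
  ('E_P[fun w => (norm2 (y w) ^+ 2)%R] =
    (dotv x x - m%:R^-1 * \sum_i dotv (arow A i) x ^+ 2)%R%:E)%E.
Proof.
move=> m_gt0 A1 [I [mI PI yE]]; rewrite unlock.
have m0 : m%:R != 0 :> R by rewrite pnatr_eq0 -lt0n.
have frob : frobenius A ^+ 2 = m%:R.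
  rewrite sqr_sqrtr; last by do 2 (apply: sumr_ge0 => ? _); rewrite sqr_ge0.
  transitivity (\sum_(i < m) norm2 (arow A i) ^+ 2).
    apply: eq_bigr => i _; rewrite norm2_sqr; apply: eq_bigr => j _.
    by rewrite !mxE expr2.
  under eq_bigr do rewrite A1 expr1n.
  by rewrite sumr_const card_ord.
under eq_integral do rewrite yE norm2_project//.
rewrite (finite_rv_integral P mI (fun i => dotv x x - dotv (arow A i) x ^+ 2)).
under eq_bigr => i _ do rewrite PI A1 frob /= expr1n div1r.
rewrite -mulr_suml sumrB sumr_const card_ord; congr (_%:E).
by rewrite -[X in (X - _) * _]mulr_natr; field.
Qed.

Theorem theorem3p2 (R : realType) :
  exists C : R, 0 < C /\
  forall (m n : nat) (A : 'M[R]_(m, n)) (x xk : 'cV[R]_n) (delta : R) (d : nat)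
    (disp : measure_display) (T : measurableType disp) (P : probability T R)
    (y : T -> 'cV[R]_n)
    (disp' : measure_display) (T' : measurableType disp')
    (P' : probability T' R) (ystar : T' -> 'cV[R]_n)
    (s : {perm 'I_m}),
  (1 <= n)%N -> (n <= m)%N ->
  \rank A = n ->
  (forall i, norm2 (arow A i) = 1) ->
  A *m x = 0 ->
  0 < delta ->
  (0 < d)%N -> d%:R = C * delta ^- 2 * ln n%:R ->
  norm2 xk <= 1 ->
  rkjl_iteration P d A xk y ->
  rk_iteration P' A xk ystar ->
  let gstar (j : 'I_m) : R := `|dotv (arow A (s j)) xk| ^+ 2 in
  (forall i j : 'I_m, (i <= j)%N -> gstar j <= gstar i) ->
  let p (j : nat) : R := rank_prob R m n j in
  [/\ ('E_P[fun w => (norm2 (y w - x) ^+ 2)%R] <=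
       mine ('E_P'[fun w => (norm2 (ystar w - x) ^+ 2)%R]
             - (\sum_(j < m) (p j.+1 - m%:R^-1) * gstar j)%R%:E
             + (2 * delta)%R%:E)
            'E_P'[fun w => (norm2 (ystar w - x) ^+ 2)%R])%E,
      forall j : nat, (1 <= j <= m)%N -> 0 <= p j,
      \sum_(1 <= j < m.+1) p j = 1,
      forall i j : nat, (1 <= i <= j)%N -> (j <= m)%N -> p j <= p i &
      p m = 0].
Proof.
exists (8192 * 900); split; first lra.
move=> m n A x xk delta d disp T P y disp' T' P' ystar s.
move=> n_gt0 n_le_m rkA A1 Ax0 delta0 d_gt0 dE xk1 rkjl rk gstar gmono p.
(* For [n = 1] the logarithm vanishes and the equation for [d] would give [d = 0]. *)
have n_gt1 : (1 < n)%N.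
  move: n_gt0; rewrite leq_eqVlt => /orP[/eqP n1|//]; exfalso.
  by move: d_gt0; rewrite -(ltr0n R) dE -n1 ln1 mulr0 ltxx.
split; last first.
- exact: rank_prob_last.
- exact: rank_prob_noninc.
- exact: sum_rank_prob.
- by move=> j _; exact: rank_prob_ge0.
(* Full column rank provides a left inverse [B]. *)
have -> : x = 0.
  have /row_fullP[B BA] : row_full A by rewrite /row_full rkA.
  by rewrite -[x]mul1mx -BA -mulmxA Ax0 mulmx0.
under eq_fun do rewrite subr0.
under [X in ('E_P'[X] - _ + _)%E]eq_fun do rewrite subr0.
under [X in mine _ ('E_P'[X])%E]eq_fun do rewrite subr0.
have m_gt0 : (0 < m)%N by exact: leq_trans n_le_m.
rewrite (rk_expectation m_gt0 A1 rk).
case: rkjl => Phi [S [J [iid wr SPhi [finJ selJ] yE]]].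
have [finS injS PS] := wr.
pose c i := dotv (arow A i) xk ^+ 2.
have gE j : gstar j = c (s j) by rewrite /gstar real_normK ?num_real.
pose k0 : 'I_n := Ordinal n_gt0.
pose K w := rkjl_test A xk (S w k0) (J w).
have finK : finite_rv K.
  exact: (finite_rv_comp (fun z : {ffun 'I_n -> 'I_m} * 'I_m =>
    rkjl_test A xk (z.1 k0) z.2) (finite_rv_pair finS finJ)).
(* [s] sends ranks to rows, so [(s^-1)%g] gives the rank of a row. The chosen row of smallest rank
   has the largest squared inner product. *)
have rankP (f : {ffun 'I_n -> 'I_m}) : exists k, forall l,
    ((s^-1)%g (f k) <= (s^-1)%g (f l))%N.
  by have [k _ kmin] := arg_minnP (fun k => val ((s^-1)%g (f k))) (erefl (xpredT k0));
    exists k => l; exact: kmin.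
have [kf kfP] := choice rankP.
pose r (f : {ffun 'I_n -> 'I_m}) := (s^-1)%g (f (kf f)).
pose best (f : {ffun 'I_n -> 'I_m}) := f (kf f).
have best_max (f : {ffun 'I_n -> 'I_m}) k : c (f k) <= c (best f).
  by rewrite -(permKV s (f k)) -(permKV s (best f)) -!gE; apply: gmono; exact: kfP.
have gap := expected_shortfall A1 xk1 iid finS SPhi selJ d_gt0 n_gt1 delta0 dE
  (best := best) (K := K).
have {}gap := gap (fun f => ex_intro _ (kf f) erefl) best_max.
have K_in w : exists k, K w = S w k.
  by rewrite /K /rkjl_test; case: ifP => _; [exists k0|have [] := selJ w].
have {}gap := gap K_in (fun w => (test_ge A xk (S w k0) (J w)).2) finK.
pose EK := \sum_i c i * fine (P (K @^-1` [set i])).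
have intK : (\int[P]_w (c (K w))%:E = EK%:E)%E by rewrite (finite_rv_integral P finK).
have Ey : ('E_P[fun w => (norm2 (y w) ^+ 2)%R] = (dotv xk xk - EK)%:E)%E.
  rewrite unlock; under eq_integral => w _ do rewrite (yE w k0)// norm2_project//.
  rewrite (finite_rv_integral P finK (fun i => dotv xk xk - c i)).
  congr (_%:E); under eq_bigr do rewrite mulrBl.
  by rewrite sumrB -mulr_sumr (sum_finite_rv P finK) mulr1.
have intbest : (\int[P]_w (c (best (S w)))%:E =
    (\sum_(j < m) p j.+1 * gstar j)%:E)%E.
  rewrite (integral_without_replacement (fun f => c (best f)) wr); congr (_%:E).
  rewrite -(sum_min_rank n_gt0 n_le_m (s := s) (r := r)); last first.
    by move=> f; split; [exact: kfP|exists (kf f)].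
  by congr (_ / _); apply: eq_bigr => f _; rewrite gE permKV.
have intfirst : (\int[P]_w (c (S w k0))%:E = (m%:R^-1 * \sum_i c i)%:E)%E.
  rewrite (integral_without_replacement (fun f : {ffun 'I_n -> 'I_m} => c (f k0)) wr).
  by rewrite (sum_inj_component n_gt0 n_le_m).
have sumg : \sum_(j < m) gstar j = \sum_i c i.
  rewrite [RHS](reindex_inj (@perm_inj _ s)); apply: eq_bigr => j _; exact: gE.
(* The row kept by the test is at least as good as the first chosen one, whose law is uniform as in
   RK. *)
have first_le : m%:R^-1 * \sum_i c i <= EK.
  rewrite -lee_fin -intfirst -intK; apply: ge0_le_integral => //.
  - by move=> w _; rewrite lee_fin sqr_ge0.
  - apply/measurable_EFinP.
    exact: (finite_rv_measurable P finS (fun f : {ffun 'I_n -> 'I_m} => c (f k0))).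
  - by apply/measurable_EFinP; exact: (finite_rv_measurable P finK).
  - by move=> w _; rewrite lee_fin; exact: (test_ge A xk (S w k0) (J w)).1.
have gapR : \sum_(j < m) p j.+1 * gstar j - EK <= 2 * delta.
  rewrite -lee_fin EFinB -intbest -intK -integralB_EFin//.
  - exact: (finite_rv_integrable P finS (fun f => c (best f))).
  - exact: (finite_rv_integrable P finK).
rewrite Ey -EFinB -EFinD -EFin_min lee_fin le_min; apply/andP; split; last first.
  by rewrite lerB.
have -> : \sum_(j < m) (p j.+1 - m%:R^-1) * gstar j =
    \sum_(j < m) p j.+1 * gstar j - m%:R^-1 * \sum_i c i.
  by rewrite -sumg mulr_sumr -sumrB; apply: eq_bigr => j _; rewrite mulrBl.
move: gapR; lra.
Qed.
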